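(* Let $\Sigma=(A,B,C,D)$ be a linear time-invariant system (in continuous or in discrete time) that satisfies the standing assumptions listed in the context. Let $\rho\in\mathbb{R}$ with $\rho<0$ in continuous time and $\rho\in(0,1)$ in discrete time. Then the Global Monotonicity Problem for $\Sigma$ and $\rho$ admits a solution $F$ if and only if $$\forall\, S\subseteq\{1,\ldots,p\}:\qquad \dim\Big(\mathcal{V}_g^\star+\sum_{j\in S}\mathcal{R}_j^\star\Big)\ \ge\ n-p+\operatorname{card}(S).$$
   Context: **System.** The time set $\mathbb{T}$ is $\mathbb{R}^+=[0,\infty)$ (continuous time) or $\mathbb{N}=\{0,1,2,\dots\}$ (discrete time). $\mathbb{C}_g$ is the open left half-plane in continuous time and the open unit disc in discrete time. $\Sigma=(A,B,C,D)$ is the system $\mathcal{D}x(t)=Ax(t)+Bu(t)$, $x(0)=x_0$, $y(t)=Cx(t)+Du(t)$, with real matrices $A\in\mathbb{R}^{n\times n}$, $B\in\mathbb{R}^{n\times m}$, $C\in\mathbb{R}^{p\times n}$, $D\in\mathbb{R}^{p\times m}$, state space $\mathcal{X}=\mathbb{R}^n$, input space $\mathcal{U}=\mathbb{R}^m$, output space $\mathcal{Y}=\mathbb{R}^p$; $\mathcal{D}x(t)$ is $\dot x(t)$ in continuous time and $x(t+1)$ in discrete time. **Invariant zeros.** $P_\Sigma(\lambda)=\begin{bmatrix}A-\lambda I_n&B\\ C&D\end{bmatrix}$. The set $\mathcal{Z}$ of invariant zeros of $\Sigma$ is the set of $\lambda\in\mathbb{C}$ at which the rank of $P_\Sigma(\lambda)$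 is strictly smaller than its normal rank $\max_{\mu\in\mathbb{C}}\operatorname{rank}P_\Sigma(\mu)$; the algebraic multiplicity of an invariant zero is its multiplicity as a root of the product of the non-zero diagonal polynomials of the Smith form of $P_\Sigma$. The minimum-phase invariant zeros are the elements of $\mathcal{Z}\cap\mathbb{C}_g$. **Subspaces.** $\mathcal{V}_g^\star$ is the largest subspace $\mathcal{V}$ of $\mathcal{X}$ for which there is $F\in\mathbb{R}^{m\times n}$ with $(A+BF)\mathcal{V}\subseteq\mathcal{V}\subseteq\ker(C+DF)$ and $\sigma(A+BF\,|\,\mathcal{V})\subset\mathbb{C}_g$. For $j\in\{1,\dots,p\}$, $C_{(j)}$ and $D_{(j)}$ are $C$ and $D$ with the $j$-th row removed, and $\Sigma_j=(A,B,C_{(j)},D_{(j)})$. $\mathcal{R}_j^\star$ is the largest output-nulling reachability subspace of $\Sigma_j$: if $\mathcal{V}_j^\star$ is the largest subspace $\mathcal{V}$ for which there is $F$ with $(A+BF)\mathcal{V}\subseteq\mathcal{V}\subseteq\ker(C_{(j)}+D_{(j)}F)$, and $F$ is any such matrix for $\mathcal{V}=\mathcal{V}_j^\star$, then $\mathcal{R}_j^\star$ is the smallest $(A+BF)$-invariant subspace containing $\mathcal{V}_j^\star\cap B\ker D_{(j)}$. **Standing assumptions.** (i) The columns of $\begin{bmatrix}B\\ D\end{bmatrix}$ are linearly independent and the rows of $[\,C\;\;D\,]$ are linearly independent. (ii) $\Sigma$ is right invertible (i.e. $P_\Sigma(\lambda)$ has full row rank $n+p$ for all but finitely many $\lambda\in\mathbb{C}$),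 the pair $(A,B)$ is stabilisable, and $\Sigma$ has no invariant zero at $0$ (continuous time), respectively at $1$ (discrete time). (iii) All minimum-phase invariant zeros of $\Sigma$ have algebraic multiplicity one. (iv) $\dim\mathcal{V}_g^\star=n-p$. **Tracking control.** For a constant reference $r\in\mathcal{Y}$, choose $x_{ss},u_{ss}$ with $Ax_{ss}+Bu_{ss}=0$ (continuous time) or $Ax_{ss}+Bu_{ss}=x_{ss}$ (discrete time), and $Cx_{ss}+Du_{ss}=r$. For $F\in\mathbb{R}^{m\times n}$, applying $u(t)=F(x(t)-x_{ss})+u_{ss}$ and setting $\xi=x-x_{ss}$ gives the closed loop $\mathcal{D}\xi(t)=(A+BF)\xi(t)$, with tracking error $\epsilon(t)=y(t)-r=(C+DF)\xi(t)\in\mathbb{R}^p$ having components $\epsilon_1,\dots,\epsilon_p$. The closed loop is asymptotically stable if $\sigma(A+BF)\subset\mathbb{C}_g$. **Global Monotonicity Problem (for $\Sigma$ and $\rho$).** Find $F\in\mathbb{R}^{m\times n}$ such that the closed loop is asymptotically stable and, for every $\xi(0)\in\mathcal{X}$ and every $k\in\{1,\dots,p\}$: there is $\beta_k\in\mathbb{R}$ with $|\epsilon_k(t)|\le\beta_k e^{\rho t}$ for all $t\in\mathbb{R}^+$ (continuous time), respectively $|\epsilon_k(t)|\le\beta_k\rho^t$ for all $t\in\mathbb{N}$ (discrete time); and $\epsilon_k$ is monotonic in $t$, strictly so as long as it is non-zero (i.e. strictly monotonic on $\{t:\epsilon_k(t)\neq0\}$). *)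

(* Defs.v *)
From HB Require Import structures.
From mathcomp Require Import all_boot all_order all_algebra.
From mathcomp Require Import all_classical all_reals all_analysis.
From mathcomp Require Import complex.

Set Implicit Arguments.
Unset Strict Implicit.
Unset Printing Implicit Defensive.

Import Order.TTheory GRing.Theory Num.Theory.
Import numFieldNormedType.Exports.

Local Open Scope classical_set_scope.
Local Open Scope ring_scope.

Inductive time_domain := continuous_time | discrete_time.

Record lti_system (R : realType) (n m p : nat) := LTISystem {
  Amx : 'M[R]_n;
  Bmx : 'M[R]_(n, m);
  Cmx : 'M[R]_(p, n);
  Dmx : 'M[R]_(p, m) }.

Section Spectrum.
Variable R : realType.

Definition stability_region (T : time_domain) : set R[i] :=
  match T with
  | continuous_time => [set z | complex.Re z < 0]
  | discrete_time => [set z | `|z| < 1]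
  end.

Definition complexify n m (M : 'M[R]_(n, m)) : 'M[R[i]]_(n, m) :=
  map_mx (real_complex R) M.

Definition spectrum n (M : 'M[R]_n) : set R[i] :=
  [set z | eigenvalue (complexify M) z].

Definition mxfun n m (M : 'M[R]_(m, n)) : 'Hom('cV[R]_n, 'cV[R]_m) :=
  linfun (mulmx M).

(* Only meaningful when V is M-invariant: column j holds the coordinates of
   M v_j in the basis (v_i) of V. *)
Definition restriction_mx n (M : 'M[R]_n) (V : {vspace 'cV[R]_n}) :
    'M[R]_(\dim V) :=
  \matrix_(i, j) coord (vbasis V) i (M *m (vbasis V)`_j).

End Spectrum.

Section Zeros.
Variables (R : realType) (n m p : nat) (Sigma : lti_system R n m p).

Definition system_pencil : 'M[{poly R[i]}]_(n + p, n + m) :=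
  block_mx
    (map_mx polyC (complexify (Amx Sigma)) - 'X%:M)
    (map_mx polyC (complexify (Bmx Sigma)))
    (map_mx polyC (complexify (Cmx Sigma)))
    (map_mx polyC (complexify (Dmx Sigma))).

Definition system_matrix (z : R[i]) : 'M[R[i]]_(n + p, n + m) :=
  map_mx (fun q : {poly R[i]} => q.[z]) system_pencil.

Definition normal_rank : nat :=
  \max_(k < (n + p).+1 | `[< exists z, \rank (system_matrix z) = k >]) k.

Definition invariant_zeros : set R[i] :=
  [set z | (\rank (system_matrix z) < normal_rank)%N].

(* Since q %| 0 for every q while 0 divides only 0, the divisibility chain
   places the zero diagonal entries last. *)
Definition is_smith_form (a b : nat) (P S : 'M[{poly R[i]}]_(a, b)) : Prop :=
  [/\ (exists (L : 'M[{poly R[i]}]_a) (M : 'M[{poly R[i]}]_b),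
         [/\ L \in unitmx, M \in unitmx & S = L *m P *m M]),
      is_diag_mx S,
      forall (i : 'I_a) (j : 'I_b), S i j != 0 -> S i j \is monic
    & forall (i i' : 'I_a) (j j' : 'I_b),
        i = j :> nat -> i' = j' :> nat -> (i <= i')%N ->
        (S i j %| S i' j')%R].

(* A Smith form exists and is unique, so the default value 0 is never used;
   the same convention is used for [largest] and [Rstar] below. *)
Definition smith_form (a b : nat) (P : 'M[{poly R[i]}]_(a, b)) :
    'M[{poly R[i]}]_(a, b) :=
  xget 0 [set S | is_smith_form P S].

Definition zero_polynomial : {poly R[i]} :=
  let S := smith_form system_pencil in
  \prod_(i < n + p) \prod_(j < n + m | (i == j :> nat) && (S i j != 0)) S i j.

Definition zero_multiplicity (z : R[i]) : nat := mup z zero_polynomial.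

Definition right_invertible : Prop :=
  finite_set [set z | \rank (system_matrix z) != (n + p)%N].

End Zeros.

Section Subspaces.
Variable R : realType.

Definition is_largest (vT : vectType R) (P : set {vspace vT})
    (V : {vspace vT}) : Prop :=
  P V /\ forall W, P W -> (W <= V)%VS.

Definition is_smallest (vT : vectType R) (P : set {vspace vT})
    (V : {vspace vT}) : Prop :=
  P V /\ forall W, P W -> (V <= W)%VS.

Definition largest (vT : vectType R) (P : set {vspace vT}) : {vspace vT} :=
  xget 0%VS [set V | is_largest P V].

Definition mx_invariant n (M : 'M[R]_n) (V : {vspace 'cV[R]_n}) : Prop :=
  (mxfun M @: V <= V)%VS.

Definition closed_loop n m p (Sigma : lti_system R n m p) (F : 'M[R]_(m, n)) :
    'M[R]_n :=
  Amx Sigma + Bmx Sigma *m F.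

Definition closed_output n m p (Sigma : lti_system R n m p)
    (F : 'M[R]_(m, n)) : 'M[R]_(p, n) :=
  Cmx Sigma + Dmx Sigma *m F.

Definition output_nulling n m p (Sigma : lti_system R n m p)
    (V : {vspace 'cV[R]_n}) (F : 'M[R]_(m, n)) : Prop :=
  mx_invariant (closed_loop Sigma F) V /\
  (V <= lker (mxfun (closed_output Sigma F)))%VS.

Definition Vstar n m p (Sigma : lti_system R n m p) : {vspace 'cV[R]_n} :=
  largest [set V | exists F, output_nulling Sigma V F].

Definition Vgstar (T : time_domain) n m p (Sigma : lti_system R n m p) :
    {vspace 'cV[R]_n} :=
  largest [set V | exists F, output_nulling Sigma V F /\
    spectrum (restriction_mx (closed_loop Sigma F) V) `<=` stability_region T].

(* The reachability subspace does not depend on the friend F of Vstar. *)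
Definition Rstar n m p (Sigma : lti_system R n m p) : {vspace 'cV[R]_n} :=
  let V := Vstar Sigma in
  let BkerD := (mxfun (Bmx Sigma) @: lker (mxfun (Dmx Sigma)))%VS in
  xget 0%VS [set W | exists F, output_nulling Sigma V F /\
    is_smallest [set U | mx_invariant (closed_loop Sigma F) U /\
                         (V :&: BkerD <= U)%VS] W].

Definition remove_output n m p (Sigma : lti_system R n m p) (j : 'I_p) :
    lti_system R n m p.-1 :=
  LTISystem (Amx Sigma) (Bmx Sigma) (row' j (Cmx Sigma)) (row' j (Dmx Sigma)).

Definition Rstar_without n m p (Sigma : lti_system R n m p) (j : 'I_p) :
    {vspace 'cV[R]_n} :=
  Rstar (remove_output Sigma j).

End Subspaces.

Section Control.
Variables (R : realType) (T : time_domain) (n m p : nat).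
Variable Sigma : lti_system R n m p.

Definition asymptotically_stable (F : 'M[R]_(m, n)) : Prop :=
  spectrum (closed_loop Sigma F) `<=` stability_region T.

Definition stabilisable : Prop := exists F, asymptotically_stable F.

Definition steady_state_point : R[i] :=
  match T with continuous_time => 0 | discrete_time => 1 end.

Record standing_assumptions : Prop := StandingAssumptions {
  input_columns_free : row_free (col_mx (Bmx Sigma) (Dmx Sigma))^T;
  output_rows_free : row_free (row_mx (Cmx Sigma) (Dmx Sigma));
  sys_right_invertible : right_invertible Sigma;
  sys_stabilisable : stabilisable;
  no_steady_state_zero : ~ invariant_zeros Sigma steady_state_point;
  minimum_phase_zeros_simple : forall z, invariant_zeros Sigma z ->
    stability_region T z -> zero_multiplicity Sigma z = 1%N;
  dim_Vgstar : (\dim (Vgstar T Sigma) + p = n)%N }.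

End Control.

Section Monotonicity.
Variable R : realType.

Definition monotonic_on d (I : porderType d) (E : set I) (f : I -> R) : Prop :=
  {in E &, {homo f : s t / (s <= t)%O >-> s <= t}} \/
  {in E &, {homo f : s t / (s <= t)%O >-> t <= s}}.

Definition strictly_monotonic_on d (I : porderType d) (E : set I)
    (f : I -> R) : Prop :=
  {in E &, {homo f : s t / (s < t)%O >-> s < t}} \/
  {in E &, {homo f : s t / (s < t)%O >-> t < s}}.

(* [time] is the time set inside the index type I, [decay] the function
   e^(rho t) or rho^t. *)
Definition monotonic_decay d (I : porderType d) (time : set I)
    (decay : I -> R) (e : I -> R) : Prop :=
  [/\ (exists beta : R, forall t, time t -> `|e t| <= beta * decay t),
      monotonic_on time e
    & strictly_monotonic_on (time `&` [set t | e t != 0]) e].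

Definition ct_trajectory n (M : 'M[R]_n) (xi : R -> 'cV[R]_n) : Prop :=
  {within `[0, +oo[, continuous xi} /\
  forall t : R, 0 < t -> is_derive t (1 : R) xi (M *m xi t).

Definition dt_trajectory n (M : 'M[R]_n) (xi : nat -> 'cV[R]_n) : Prop :=
  forall t, xi t.+1 = M *m xi t.

Definition tracking_error n m p (Sigma : lti_system R n m p)
    (F : 'M[R]_(m, n)) (I : Type) (xi : I -> 'cV[R]_n) (k : 'I_p) (t : I) : R :=
  (closed_output Sigma F *m xi t) k 0.

(* Quantifying over trajectories amounts to quantifying over the initial
   state xi 0, which determines the trajectory on the time set. *)
Definition solves_global_monotonicity (T : time_domain) n m p
    (Sigma : lti_system R n m p) (rho : R) (F : 'M[R]_(m, n)) : Prop :=
  asymptotically_stable T Sigma F /\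
  match T with
  | continuous_time =>
      forall xi : R -> 'cV[R]_n, ct_trajectory (closed_loop Sigma F) xi ->
      forall k : 'I_p,
        monotonic_decay `[0, +oo[ (fun t => expR (rho * t))
          (tracking_error Sigma F xi k)
  | discrete_time =>
      forall xi : nat -> 'cV[R]_n, dt_trajectory (closed_loop Sigma F) xi ->
      forall k : 'I_p,
        monotonic_decay setT (fun t => rho ^+ t)
          (tracking_error Sigma F xi k)
  end.

Definition admissible_rate (T : time_domain) (rho : R) : Prop :=
  match T with
  | continuous_time => rho < 0
  | discrete_time => 0 < rho < 1
  end.

End Monotonicity.

(* Main.v *)
(* If [F] solves the problem, a component of the tracking error that starts at
   0 is monotonic and tends to 0, so it vanishes; hence every row of
   [C_F = C + D F] is a left eigenvector of [A_F = A + B F] and, by dimension,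
   [ker C_F] is the subspace [Vg]. Maximality of [Vg] makes the pencil
   [G(s) = C_F B - Lam D + s D], [Lam] the diagonal matrix of the eigenvalues,
   right invertible at each of them; solving with it near the [j]-th eigenvalue
   gives vectors of [Rstar_j] whose images under [C_F] tend to the basis vector
   [e_j]. Hence [C_F] maps [Rstar_j] onto a subspace containing [e_j], which
   gives the dimension inequalities.
   Conversely [Rstar_j] is spanned, for almost every choice of sufficiently many
   real rates [mu], by vectors [v] with [A v + B w = mu v] and [C v + D w] a
   multiple of [e_j]. Rado's theorem selects one such [v_j] for each [j] so that
   they complement [Vg]; a feedback that agrees on [Vg] with one that stabilises
   it and maps [v_j] to [w_j] makes each tracking error a pure exponential. *)
Require Import Defs.
From mathcomp Require Import all_boot all_order all_algebra.
From mathcomp Require Import all_classical all_reals all_analysis.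
From mathcomp Require Import complex ring zify.

Set Implicit Arguments.
Unset Strict Implicit.
Unset Printing Implicit Defensive.

Import Order.TTheory GRing.Theory Num.Theory.
Import numFieldNormedType.Exports.

Local Open Scope classical_set_scope.
Local Open Scope ring_scope.

(** * Stable spectra in real terms *)

(** [largest] and [Rstar] fall back on the zero space, so nothing can be said about them before the
    extremal subspaces are shown to exist. For [Vstar], friends of V and W are glued on
    complementary subspaces. For [Vgstar] this is not enough: V ∩ W need not be invariant under the
    friend of W, so the map induced on a complement of V in V + W depends on that complement and may
    be unstable. The remedy is to enlarge V by part of W only, along a complement that is orthogonal
    for a suitable semidefinite form; the induced map is then a compression, whose eigenvalues can
    be controlled. Complex eigenvectors are carried as pairs of real vectors, so that all subspaces
    and feedbacks stay real. Genericity of a rate always means avoiding the roots of one nonzero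
    polynomial. Limits over rates thereby become polynomial identities, and finitely many bad rates
    can be dodged while keeping the prescribed decay. *)

Section ComplexVectors.
Variable R : realType.

Definition re_mx n m (M : 'M[R[i]]_(n, m)) : 'M[R]_(n, m) :=
  map_mx (@complex.Re R) M.
Definition im_mx n m (M : 'M[R[i]]_(n, m)) : 'M[R]_(n, m) :=
  map_mx (@complex.Im R) M.

Lemma re_sum I (r : seq I) (P : pred I) (F : I -> R[i]) :
  complex.Re (\sum_(i <- r | P i) F i) = \sum_(i <- r | P i) complex.Re (F i).
Proof. by apply: (big_morph (@complex.Re R)) => // -[? ?] [? ?]. Qed.

Lemma im_sum I (r : seq I) (P : pred I) (F : I -> R[i]) :
  complex.Im (\sum_(i <- r | P i) F i) = \sum_(i <- r | P i) complex.Im (F i).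
Proof. by apply: (big_morph (@complex.Im R)) => // -[? ?] [? ?]. Qed.

Lemma complex_mx_eqP n m (M N : 'M[R[i]]_(n, m)) :
  M = N <-> re_mx M = re_mx N /\ im_mx M = im_mx N.
Proof.
split=> [->//|[/matrixP hre /matrixP him]]; apply/matrixP => i j.
have := hre i j; have := him i j; rewrite !mxE.
by case: (M i j) (N i j) => [? ?] [? ?] /= -> ->.
Qed.

Lemma re_mul_complexify n m k (M : 'M[R]_(n, m)) (Z : 'M[R[i]]_(m, k)) :
  re_mx (complexify M *m Z) = M *m re_mx Z.
Proof.
apply/matrixP => i j; rewrite !mxE re_sum; apply: eq_bigr => l _.
by rewrite !mxE; case: (Z l j) => a b /=; rewrite mul0r subr0.
Qed.

Lemma im_mul_complexify n m k (M : 'M[R]_(n, m)) (Z : 'M[R[i]]_(m, k)) :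
  im_mx (complexify M *m Z) = M *m im_mx Z.
Proof.
apply/matrixP => i j; rewrite !mxE im_sum; apply: eq_bigr => l _.
by rewrite !mxE; case: (Z l j) => a b /=; rewrite mul0r addr0.
Qed.

Lemma re_mxZ n m (z : R[i]) (Z : 'M[R[i]]_(n, m)) :
  re_mx (z *: Z) = complex.Re z *: re_mx Z - complex.Im z *: im_mx Z.
Proof. by apply/matrixP => i j; rewrite !mxE; case: z (Z i j) => ? ? [? ?]. Qed.

Lemma im_mxZ n m (z : R[i]) (Z : 'M[R[i]]_(n, m)) :
  im_mx (z *: Z) = complex.Im z *: re_mx Z + complex.Re z *: im_mx Z.
Proof.
by apply/matrixP => i j; rewrite !mxE; case: z (Z i j) => ? ? [? ?] /=;
  rewrite addrC.
Qed.

Lemma complex_mx_eq0 n m (Z : 'M[R[i]]_(n, m)) :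
  (Z == 0) = (re_mx Z == 0) && (im_mx Z == 0).
Proof.
apply/eqP/andP => [->|[/eqP h1 /eqP h2]].
  by split; apply/eqP/matrixP => i j; rewrite !mxE.
by apply/complex_mx_eqP; split; [rewrite h1|rewrite h2];
  apply/matrixP => i j; rewrite !mxE.
Qed.

Lemma eigenvalue_trmx (K : fieldType) n (M : 'M[K]_n) (a : K) :
  eigenvalue M^T a = eigenvalue M a.
Proof.
rewrite !eigenvalue_root_char; congr (root _ a); rewrite /char_poly.
rewrite -det_tr; congr (\det _); rewrite /char_poly_mx.
by apply/matrixP => i j; rewrite !mxE eq_sym.
Qed.

(** Real and imaginary parts of M (x + iy) = (a + ib)(x + iy). The transposition is there because
    [eigenvalue] refers to row vectors. *)
Lemma spectrumP n (M : 'M[R]_n) (a b : R) :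
  spectrum M (Complex a b) <->
  exists x y : 'cV[R]_n, [/\ (x != 0) || (y != 0),
    M *m x = a *: x - b *: y & M *m y = b *: x + a *: y].
Proof.
rewrite /spectrum /= -eigenvalue_trmx; split.
  case/eigenvalueP => v hv vn0.
  have hv' : complexify M *m v^T = Complex a b *: v^T.
    by apply: trmx_inj; rewrite trmx_mul trmxK hv linearZ /= trmxK.
  move/complex_mx_eqP: hv'; rewrite re_mul_complexify im_mul_complexify.
  rewrite re_mxZ im_mxZ => -[h1 h2].
  exists (re_mx v^T), (im_mx v^T); split => //.
  rewrite -negb_and -complex_mx_eq0; apply: contra vn0 => /eqP h.
  by rewrite -[v]trmxK h trmx0.
case=> x [y [xy hx hy]].
pose Z : 'cV[R[i]]_n := \matrix_(i, j) Complex (x i j) (y i j).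
have reZ : re_mx Z = x by apply/matrixP => i j; rewrite !mxE.
have imZ : im_mx Z = y by apply/matrixP => i j; rewrite !mxE.
apply/eigenvalueP; exists Z^T; last first.
  have Zn0 : Z != 0 by rewrite complex_mx_eq0 negb_and reZ imZ.
  by apply: contra Zn0 => /eqP h; rewrite -[Z]trmxK h trmx0.
rewrite -trmx_mul -linearZ /=; congr trmx.
apply/complex_mx_eqP; rewrite re_mul_complexify im_mul_complexify.
by rewrite re_mxZ im_mxZ reZ imZ.
Qed.

Lemma spectrum_rowP n (M : 'M[R]_n) (a b : R) :
  spectrum M (Complex a b) <->
  exists x y : 'rV[R]_n, [/\ (x != 0) || (y != 0),
    x *m M = a *: x - b *: y & y *m M = b *: x + a *: y].
Proof.
have -> : spectrum M (Complex a b) <-> spectrum M^T (Complex a b).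
  by rewrite /spectrum /= /complexify -map_trmx eigenvalue_trmx.
rewrite spectrumP; split=> -[x [y [xy hx hy]]]; exists x^T, y^T.
  by split; [by rewrite !trmx_eq0| |]; apply: trmx_inj;
    rewrite trmx_mul trmxK ?hx ?hy linearD ?linearN /= !linearZ /= !trmxK.
by split; [by rewrite !trmx_eq0| |];
   rewrite -trmx_mul ?hx ?hy linearD ?linearN /= !linearZ.
Qed.

End ComplexVectors.

Section Stability.
Variables (R : realType) (T : time_domain).

Definition stable_point (a b : R) : bool :=
  match T with
  | continuous_time => a < 0
  | discrete_time => a ^+ 2 + b ^+ 2 < 1
  end.

Lemma stability_regionE (a b : R) :
  stability_region T (Complex a b) <-> stable_point a b.
Proof.
rewrite /stability_region /stable_point; case: T => //=.
rewrite -(ltr_pXn2r (n := 2)) ?nnegrE ?normr_ge0 ?ler01 //.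
by rewrite -add_Re2_Im2 expr1n /= (_ : 1 = (1 : R)%:C)%C // ltcR.
Qed.

(* The hypotheses say that [x + i y] is an eigenvector for [a + i b]. *)
Definition stable_on n (M : 'M[R]_n) (V : {vspace 'cV[R]_n}) : Prop :=
  forall x y a b, x \in V -> y \in V -> (x != 0) || (y != 0) ->
    M *m x = a *: x - b *: y -> M *m y = b *: x + a *: y -> stable_point a b.

Lemma stable_fullP n (M : 'M[R]_n) :
  spectrum M `<=` stability_region T <-> stable_on M fullv.
Proof.
split=> [h x y a b _ _ xy hx hy|h [a b] /spectrumP[x [y [xy hx hy]]]].
  by apply/stability_regionE/h/spectrumP; exists x, y.
by apply/stability_regionE; apply: (h x y); rewrite ?memvf.
Qed.

Lemma mxfunE n m (M : 'M[R]_(m, n)) v : mxfun M v = M *m v.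
Proof. by rewrite /mxfun lfunE. Qed.

Lemma mx_invariantP n (M : 'M[R]_n) (V : {vspace 'cV[R]_n}) :
  mx_invariant M V <-> forall v, v \in V -> M *m v \in V.
Proof.
split=> [/subvP h v vV|h]; first by rewrite -mxfunE; apply/h/memv_img.
by apply/subvP => _ /memv_imgP[v vV ->]; rewrite mxfunE; apply: h.
Qed.

Definition basis_mx n (V : {vspace 'cV[R]_n}) : 'M[R]_(n, \dim V) :=
  \matrix_(i, j) (vbasis V)`_j i 0.

Lemma basis_mxE n (V : {vspace 'cV[R]_n}) (c : 'cV[R]_(\dim V)) :
  basis_mx V *m c = \sum_j c j 0 *: (vbasis V)`_j.
Proof.
apply/matrixP => i k; rewrite ord1 !mxE summxE; apply: eq_bigr => j _.
by rewrite !mxE mulrC.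
Qed.

Lemma basis_mx_mem n (V : {vspace 'cV[R]_n}) (c : 'cV[R]_(\dim V)) :
  basis_mx V *m c \in V.
Proof.
rewrite basis_mxE memv_suml // => j _; apply/memvZ/vbasis_mem/mem_nth.
by rewrite size_tuple.
Qed.

Lemma basis_mxP n (V : {vspace 'cV[R]_n}) v :
  v \in V -> exists c, v = basis_mx V *m c.
Proof.
move=> vV; exists (\col_j coord (vbasis V) j v).
rewrite basis_mxE {1}(coord_vbasis vV).
by apply: eq_bigr => j _; rewrite mxE.
Qed.

Lemma basis_mx_inj n (V : {vspace 'cV[R]_n}) (c : 'cV[R]_(\dim V)) :
  basis_mx V *m c = 0 -> c = 0.
Proof.
rewrite basis_mxE => h.
have /freeP/(_ _ h) hc := basis_free (vbasisP V).
by apply/matrixP => j k; rewrite ord1 hc mxE.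
Qed.

Lemma restriction_mxE n (M : 'M[R]_n) (V : {vspace 'cV[R]_n}) :
  mx_invariant M V -> M *m basis_mx V = basis_mx V *m restriction_mx M V.
Proof.
move=> /mx_invariantP h; apply/matrixP => i j.
set b := (vbasis V)`_j.
have bV : b \in V by apply/vbasis_mem/mem_nth; rewrite size_tuple.
have -> : (M *m basis_mx V) i j = (M *m b) i 0.
  by rewrite !mxE; apply: eq_bigr => k _; rewrite mxE.
rewrite (coord_vbasis (h _ bV)) summxE mxE.
by apply: eq_bigr => k _; rewrite !mxE mulrC.
Qed.

Lemma stable_onP n (M : 'M[R]_n) (V : {vspace 'cV[R]_n}) :
  mx_invariant M V ->
  spectrum (restriction_mx M V) `<=` stability_region T <-> stable_on M V.
Proof.
move=> hM; have hE := restriction_mxE hM; split.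
  move=> h x y a b /basis_mxP[c ->] /basis_mxP[d ->] cd hx hy.
  apply/stability_regionE/h/spectrumP; exists c, d; split.
  - by apply: contraTT cd; rewrite !negb_or !negbK => /andP[/eqP-> /eqP->];
      rewrite mulmx0 eqxx.
  - apply/eqP; rewrite -subr_eq0; apply/eqP/basis_mx_inj.
    by rewrite !mulmxBr mulmxA -hE -mulmxA hx -!scalemxAr subrr.
  - apply/eqP; rewrite -subr_eq0; apply/eqP/basis_mx_inj.
    by rewrite mulmxBr mulmxDr mulmxA -hE -mulmxA hy -!scalemxAr subrr.
move=> h [a b] /spectrumP[c [d [cd hc hd]]]; apply/stability_regionE.
apply: (h (basis_mx V *m c) (basis_mx V *m d)); rewrite ?basis_mx_mem //.
- by apply: contraTT cd; rewrite !negb_or !negbK => /andP[/eqP h1 /eqP h2];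
    rewrite (basis_mx_inj h1) (basis_mx_inj h2) eqxx.
- by rewrite mulmxA hE -mulmxA hc mulmxBr -!scalemxAr.
- by rewrite mulmxA hE -mulmxA hd mulmxDr -!scalemxAr.
Qed.

Lemma stable_on_sub n (M : 'M[R]_n) (V W : {vspace 'cV[R]_n}) :
  (V <= W)%VS -> stable_on M W -> stable_on M V.
Proof. by move=> /subvP h hW x y a b /h xW /h yW; apply: hW. Qed.

Lemma stable_on_ext n (M N : 'M[R]_n) (V : {vspace 'cV[R]_n}) :
  {in V, forall v, M *m v = N *m v} -> stable_on M V -> stable_on N V.
Proof.
by move=> h hM x y a b xV yV xy hx hy; apply: (hM x y) => //; rewrite h.
Qed.

(** [M] acts on the quotient of [V + <[v]>] by [V] as the scalar [mu]. If the eigenvector has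
    [v]-components s and t, then (a + ib)(s + it) = mu (s + it): either s = t = 0 and the
    eigenvector lies in [V], or a + ib = mu. *)
Lemma stable_on_line n (M : 'M[R]_n) (V : {vspace 'cV[R]_n}) v mu :
  mx_invariant M V -> v \notin V -> M *m v - mu *: v \in V ->
  stable_point mu 0 -> stable_on M V -> stable_on M (V + <[v]>)%VS.
Proof.
move=> /mx_invariantP hM vV hv hmu hV x y a b.
case/memv_addP => x1 x1V [_ /vlineP[s ->] ->].
case/memv_addP => y1 y1V [_ /vlineP[t ->] ->] xy hx hy.
have key (z z' : 'cV_n) k k' : z \in V -> z' \in V ->
    M *m (z + k *: v) = z' + k' *: v -> k * mu = k'.
  move=> zV z'V h; apply/eqP; rewrite -subr_eq0; apply: contraNT vV => kn0.
  suff : (k * mu - k') *: v \in V by rewrite rpredZeq (negPf kn0).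
  have -> : (k * mu - k') *: v = z' - M *m z - k *: (M *m v - mu *: v).
    move: h; rewrite mulmxDr -scalemxAr scalerBr => /(canRL (addKr _)) ->.
    by apply/matrixP => i j; rewrite !mxE; ring.
  by rewrite rpredB ?rpredB ?rpredZ ?hM.
have ks : s * mu = a * s - b * t.
  apply: (key x1 (a *: x1 - b *: y1)); rewrite ?rpredB ?rpredZ // hx.
  by apply/matrixP => i j; rewrite !mxE; ring.
have kt : t * mu = b * s + a * t.
  apply: (key y1 (b *: x1 + a *: y1)); rewrite ?rpredD ?rpredZ // hy.
  by apply/matrixP => i j; rewrite !mxE; ring.
have st_ge0 : 0 <= s ^+ 2 + t ^+ 2 by rewrite addr_ge0 ?sqr_ge0.
have [st0|st0] := eqVneq (s ^+ 2 + t ^+ 2) 0.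
  have /eqP : s ^+ 2 + t ^+ 2 == 0 by apply/eqP.
  move/eqP; rewrite paddr_eq0 ?sqr_ge0 // !sqrf_eq0 => /andP[/eqP s0 /eqP t0].
  move: hx hy xy; rewrite s0 t0 !scale0r !addr0 => hx hy xy.
  exact: (hV x1 y1).
have -> : a = mu.
  apply: (mulIf st0); apply/eqP; rewrite -subr_eq0; apply/eqP.
  transitivity (s * (a * s - b * t - s * mu) + t * (b * s + a * t - t * mu)).
    by ring.
  by rewrite -ks -kt !subrr !mulr0 addr0.
suff -> : b = 0 by [].
apply: (mulIf st0); rewrite mul0r.
transitivity (s * (b * s + a * t - t * mu) - t * (a * s - b * t - s * mu)).
  by ring.
by rewrite -ks -kt !subrr !mulr0 subr0.
Qed.
End Stability.

(** * Output-nulling subspaces and their friends *)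

Section ExtremalSubspaces.
Variables (R : realType) (vT : vectType R).
Implicit Types P : set {vspace vT}.

Lemma exists_max_dim P V0 : P V0 ->
  exists V, P V /\ forall W, P W -> (\dim W <= \dim V)%N.
Proof.
move=> PV0.
have ex : exists k, `[< exists V, P V /\ \dim V = k >].
  by exists (\dim V0); apply/asboolP; exists V0.
have ub k : `[< exists V, P V /\ \dim V = k >] -> (k <= \dim {: vT})%N.
  by move/asboolP => [V [_ <-]]; apply/dimvS/subvf.
case: (ex_maxnP ex ub) => k /asboolP[V [PV <-]] h.
by exists V; split=> // W PW; apply: h; apply/asboolP; exists W.
Qed.

Lemma exists_min_dim P V0 : P V0 ->
  exists V, P V /\ forall W, P W -> (\dim V <= \dim W)%N.
Proof.
move=> PV0.
have ex : exists k, `[< exists V, P V /\ \dim V = k >].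
  by exists (\dim V0); apply/asboolP; exists V0.
case: (ex_minnP ex) => k /asboolP[V [PV <-]] h.
by exists V; split=> // W PW; apply: h; apply/asboolP; exists W.
Qed.

Lemma largest_mem P : P 0%VS -> P (largest P).
Proof. by move=> P0; rewrite /largest; case: xgetP => [V _ []|]. Qed.

Lemma largest_sup P W : P 0%VS ->
  (forall V W, P V -> P W -> ~~ (W <= V)%VS ->
    exists V', [/\ P V', (V <= V')%VS & ~~ (V' <= V)%VS]) ->
  P W -> (W <= largest P)%VS.
Proof.
move=> P0 grow PW.
have [V [PV maxV]] := exists_max_dim P0.
have lV : is_largest P V.
  split=> // U PU; apply: contraT => nUV.
  have [V' [PV' VV' nV'V]] := grow _ _ PV PU nUV.
  have := eqEdim V V'; rewrite VV' maxV // => /eqP VE.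
  by rewrite VE subvv in nV'V.
by have [_] := xgetI 0%VS lV; apply.
Qed.

End ExtremalSubspaces.

Section Feedback.
Variable R : realType.

Lemma lfun_mx n m (f : {linear 'cV[R]_n -> 'cV[R]_m}) :
  exists M : 'M[R]_(m, n), forall v, M *m v = f v.
Proof.
exists (\matrix_(i, j) f (delta_mx j 0) i 0) => v.
rewrite [in RHS](matrix_sum_delta v) linear_sum; apply/matrixP => i k.
rewrite ord1 mxE summxE; apply: eq_bigr => j _.
by rewrite big_ord1 linearZ !mxE mulrC.
Qed.

Lemma glue_feedback n m (V L : {vspace 'cV[R]_n}) (F G : 'M[R]_(m, n)) :
  (V :&: L = 0)%VS -> exists H : 'M[R]_(m, n),
    {in V, forall v, H *m v = F *m v} /\ {in L, forall v, H *m v = G *m v}.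
Proof.
move=> VL; have [P hP] := lfun_mx (daddv_pi L V).
(* [P] projects onto [L] along [V]. *)
exists (F + (G - F) *m P); split=> v hv; rewrite mulmxDl -mulmxA hP /=.
  suff -> : daddv_pi L V v = 0 by rewrite mulmx0 addr0.
  have /(daddv_pi_add VL) : v \in (V + L)%VS by rewrite (subvP (addvSl _ _)).
  by rewrite (daddv_pi_id VL hv) => /(canRL (addKr _)); rewrite addNr.
by rewrite daddv_pi_id 1?capvC // mulmxBl addrC subrK.
Qed.

Lemma extend_feedback n m (V : {vspace 'cV[R]_n}) (F : 'M[R]_(m, n)) v w :
  v \notin V -> exists H : 'M[R]_(m, n),
    {in V, forall u, H *m u = F *m u} /\ H *m v = w.
Proof.
move=> vV.
have vn0 : v != 0 by apply: contraNneq vV => ->; rewrite mem0v.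
have [i vi] : exists i, v i 0 != 0.
  by have /cV0Pn := vn0.
have VL : (V :&: <[v]> = 0)%VS.
  apply/eqP; rewrite -subv0; apply/subvP => u.
  rewrite memv_cap => /andP[uV /vlineP[k uk]]; move: uV; rewrite uk.
  by rewrite rpredZeq (negPf vV) orbF => /eqP ->; rewrite scale0r mem0v.
(* A rank-one matrix: the row factor takes the value 1 at [v], so [G] sends [v] to [w]. *)
pose G := w *m (((v i 0)^-1) *: delta_mx 0 i).
have [H [HV Hv]] := glue_feedback F G VL.
exists H; split=> //; rewrite Hv ?memv_line // /G -mulmxA -scalemxAl -rowE.
have -> : (v i 0)^-1 *: row i v = 1%:M.
  by apply/matrixP => a b; rewrite !ord1 !mxE mulVf.
by rewrite mulmx1.
Qed.

Lemma capv0_decomp (vT : vectType R) (V L : {vspace vT}) x y k l :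
  (V :&: L = 0)%VS -> x \in V -> y \in V -> k \in L -> l \in L ->
  x + k = y + l -> k = l.
Proof.
move=> VL xV yV kL lL h.
suff : k - l \in (V :&: L)%VS by rewrite VL memv0 subr_eq0 => /eqP.
rewrite memv_cap [k - l \in L]rpredB // andbT.
have -> : k - l = y - x.
  by apply/eqP; rewrite subr_eq addrAC -h addrAC subrr add0r.
by rewrite rpredB.
Qed.

End Feedback.

Section OutputNulling.
Variables (R : realType) (n m p : nat) (Sigma : lti_system R n m p).
Implicit Types (V W : {vspace 'cV[R]_n}) (F : 'M[R]_(m, n)).

Lemma output_nullingP V F : output_nulling Sigma V F <->
  forall v, v \in V ->
    closed_loop Sigma F *m v \in V /\ closed_output Sigma F *m v = 0.
Proof.
split=> [[/mx_invariantP h /subvP h'] v vV|h].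
  by split; [exact: h|have := h' v vV; rewrite memv_ker mxfunE => /eqP].
split; first by apply/mx_invariantP => v /h[].
by apply/subvP => v /h[_ hv]; rewrite memv_ker mxfunE hv.
Qed.

Lemma closed_loopE F (x : 'cV_n) :
  closed_loop Sigma F *m x = Amx Sigma *m x + Bmx Sigma *m (F *m x).
Proof. by rewrite /closed_loop mulmxDl mulmxA. Qed.

Lemma closed_outputE F (x : 'cV_n) :
  closed_output Sigma F *m x = Cmx Sigma *m x + Dmx Sigma *m (F *m x).
Proof. by rewrite /closed_output mulmxDl mulmxA. Qed.

Lemma output_nulling0 F : output_nulling Sigma 0%VS F.
Proof.
by apply/output_nullingP => v; rewrite memv0 => /eqP->; rewrite !mulmx0 mem0v.
Qed.

Lemma output_nulling_sum V W F G :
  output_nulling Sigma V F -> output_nulling Sigma W G ->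
  exists H, output_nulling Sigma (V + W)%VS H.
Proof.
move=> /output_nullingP hV /output_nullingP hW.
have VL : (V :&: (W :\: V) = 0)%VS by rewrite capvC capv_diff.
have [H [HV HL]] := glue_feedback F G VL; exists H.
rewrite addvC -addv_diff; apply/output_nullingP => _ /memv_addP[w wL [v vV ->]].
have wW : w \in W by apply: subvP wL; apply: diffvSl.
have [v1 v2] := hV _ vV; have [w1 w2] := hW _ wW.
rewrite !mulmxDr; split.
  apply: rpredD.
    rewrite closed_loopE HL // -closed_loopE addv_diff.
    exact: subvP (addvSl _ _) _ w1.
  rewrite closed_loopE HV // -closed_loopE.
  exact: subvP (addvSr _ _) _ v1.
by rewrite !closed_outputE HL // HV // -!closed_outputE v2 w2 addr0.
Qed.

Lemma Vstar_nulling : exists F, output_nulling Sigma (Vstar Sigma) F.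
Proof.
apply: (@largest_mem _ _ [set V | exists F, output_nulling Sigma V F]).
by exists 0; apply: output_nulling0.
Qed.

Lemma Vstar_sup V F : output_nulling Sigma V F -> (V <= Vstar Sigma)%VS.
Proof.
move=> hV; apply: largest_sup; last by exists F.
  by exists 0; apply: output_nulling0.
move=> U W [FU hU] [FW hW] nWU.
exists (U + W)%VS; split; [exact: output_nulling_sum hU hW|exact: addvSl|].
by rewrite subv_add negb_and nWU orbT.
Qed.

End OutputNulling.

(** * Existence of the largest stably output-nulling subspace *)

Section Compression.
Variables (R : realType) (T : time_domain).

(** Solvability of the normal equations, for [Z] of any rank: a row w = x Z^T with w Z = 0 has w w^T
    = 0, hence vanishes over the reals, so passing to the Gram matrix loses no rank. *)
Lemma gram_submx k n (Z : 'M[R]_(k, n)) : (Z <= Z^T *m Z)%MS.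
Proof.
have rk : \rank (Z^T *m Z) = \rank Z.
  rewrite -[RHS]mxrank_tr -(mxrank_mul_ker Z^T Z).
  suff h : \rank (Z^T :&: kermx Z) = 0%N by rewrite h addn0.
  apply/eqP; rewrite mxrank_eq0; apply/rowV0P => w.
  rewrite sub_capmx => /andP[/submxP[x wx] /sub_kermxP wZ].
  have ww : w *m w^T = 0 by rewrite {2}wx trmx_mul trmxK mulmxA wZ mul0mx.
  apply/matrixP => i j; rewrite ord1 mxE.
  have := congr1 (fun M : 'M[R]_1 => M 0 0) ww; rewrite !mxE => /psumr_eq0P.
  move/(_ _ j isT)/eqP.
  rewrite mxE -expr2 sqrf_eq0 => h; apply/eqP/h => l _.
  by rewrite mxE -expr2 sqr_ge0.
by have [_ heq] := mxrank_leqif_sup (submxMl Z^T Z); rewrite -heq rk.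
Qed.

(** The form |Phi v|^2 may be degenerate, so the projection onto [U] is not unique; any solution of
    the normal equations gives one. *)
Lemma semidefinite_projection k n (Phi : 'M[R]_(k, n))
    (U : {vspace 'cV[R]_n}) v :
  exists2 u, u \in U &
    forall w, w \in U -> (Phi *m w)^T *m (Phi *m (v - u)) = 0.
Proof.
pose Z := Phi *m basis_mx U.
have /submxP[c hc] : ((Phi *m v)^T *m Z <= Z^T *m Z)%MS.
  exact: submx_trans (submxMl _ _) (gram_submx Z).
exists (basis_mx U *m c^T); first exact: basis_mx_mem.
move=> w /basis_mxP[d ->]; rewrite mulmxBr !mulmxA -/Z trmx_mul -mulmxA.
suff -> : Z^T *m (Phi *m v - Z *m c^T) = 0 by rewrite mulmx0.
rewrite mulmxBr; apply/eqP; rewrite subr_eq0; apply/eqP.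
by apply: trmx_inj; rewrite [LHS]trmx_mul trmxK hc !trmx_mul !trmxK !mulmxA.
Qed.

(* [a + i b] acts on the plane, [x] and [y] are orthogonal to the images
   [p], [r]: the compression of the action to the orthogonal complement has
   only eigenvalues [a' + i b'] at least as stable as [a + i b]. *)
Lemma compression_stable (a b a' b' p1 p2 r1 r2 x1 x2 y1 y2 : R) :
  stable_point T a b -> 0 < p1 ^+ 2 + p2 ^+ 2 + (r1 ^+ 2 + r2 ^+ 2) ->
  x1 * p1 + x2 * p2 = 0 -> x1 * r1 + x2 * r2 = 0 ->
  y1 * p1 + y2 * p2 = 0 -> y1 * r1 + y2 * r2 = 0 ->
  a * p1 - b * p2 = x1 + (a' * p1 - b' * r1) ->
  b * p1 + a * p2 = x2 + (a' * p2 - b' * r2) ->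
  a * r1 - b * r2 = y1 + (b' * p1 + a' * r1) ->
  b * r1 + a * r2 = y2 + (b' * p2 + a' * r2) ->
  stable_point T a' b'.
Proof.
set E := (X in 0 < X) => sab E0 xp xr yp yr h1 h2 h3 h4.
rewrite /stable_point in sab *; case: T sab => sab.
  (* Pairing the equations with p and with r removes x and y; the two b' terms cancel in the sum.
     The real part is therefore unchanged. *)
  suff : a' * E = a * E by move/(mulIf (lt0r_neq0 E0)) ->.
  have e1 : a * (p1 ^+ 2 + p2 ^+ 2) =
            a' * (p1 ^+ 2 + p2 ^+ 2) - b' * (r1 * p1 + r2 * p2).
    transitivity ((a * p1 - b * p2) * p1 + (b * p1 + a * p2) * p2); first by ring.
    rewrite h1 h2; transitivity (x1 * p1 + x2 * p2 +
      (a' * (p1 ^+ 2 + p2 ^+ 2) - b' * (r1 * p1 + r2 * p2))); first by ring.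
    by rewrite xp add0r.
  have e2 : a * (r1 ^+ 2 + r2 ^+ 2) =
            a' * (r1 ^+ 2 + r2 ^+ 2) + b' * (r1 * p1 + r2 * p2).
    transitivity ((a * r1 - b * r2) * r1 + (b * r1 + a * r2) * r2); first by ring.
    rewrite h3 h4; transitivity (y1 * r1 + y2 * r2 +
      (a' * (r1 ^+ 2 + r2 ^+ 2) + b' * (r1 * p1 + r2 * p2))); first by ring.
    by rewrite yr add0r.
  by rewrite /E mulrDr [RHS]mulrDr e1 e2; ring.
(* Pythagoras: multiplication by a + ib scales squared lengths by a^2 + b^2, and x, y are orthogonal
   to the remaining parts. Compression can only decrease the modulus. *)
have e : (a ^+ 2 + b ^+ 2) * E =
    (x1 ^+ 2 + x2 ^+ 2) + (y1 ^+ 2 + y2 ^+ 2) + (a' ^+ 2 + b' ^+ 2) * E.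
  transitivity ((a * p1 - b * p2) ^+ 2 + (b * p1 + a * p2) ^+ 2 +
    ((a * r1 - b * r2) ^+ 2 + (b * r1 + a * r2) ^+ 2)); first by rewrite /E; ring.
  rewrite h1 h2 h3 h4; apply/eqP; rewrite -subr_eq0; apply/eqP.
  transitivity (2 * a' * (x1 * p1 + x2 * p2) - 2 * b' * (x1 * r1 + x2 * r2) +
    2 * b' * (y1 * p1 + y2 * p2) + 2 * a' * (y1 * r1 + y2 * r2)).
    by rewrite /E; ring.
  by rewrite xp xr yp yr; ring.
rewrite -(ltr_pM2r E0) mul1r; 
apply: le_lt_trans (_ : (a ^+ 2 + b ^+ 2) * E < E).
  by rewrite e lerDr !addr_ge0 ?sqr_ge0.
by rewrite gtr_pMl.
Qed.

End Compression.

Section StablyNulling.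
Variables (R : realType) (T : time_domain).

Lemma complexify_eigenvalue d (N : 'M[R]_d) : (0 < d)%N ->
  exists a b, spectrum N (Complex a b).
Proof.
move=> d0; have /closed_rootP[[a b] h] : size (char_poly (complexify N)) != 1%N.
  by rewrite size_char_poly eqSS -lt0n.
by exists a, b; rewrite /spectrum /= eigenvalue_root_char.
Qed.

Lemma basis_mx_linv n (V : {vspace 'cV[R]_n}) :
  exists B : 'M[R]_(\dim V, n), B *m basis_mx V = 1%:M.
Proof.
have /row_freeP[B hB] : row_free (basis_mx V)^T.
  apply: inj_row_free => v hv; apply: trmx_inj; rewrite trmx0.
  by apply: basis_mx_inj; apply: trmx_inj; rewrite trmx_mul !trmxK hv trmx0.
by exists B^T; apply: trmx_inj; rewrite trmx_mul trmxK hB trmx1.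
Qed.

Lemma memv_lker_mx n m (M : 'M[R]_(m, n)) v :
  (v \in lker (mxfun M)) = (M *m v == 0).
Proof. by rewrite memv_ker mxfunE. Qed.

(* A complex left eigenvector [f1 + i f2] of the restriction of [M] to [V]. *)
Lemma left_eigenfunctional n (M : 'M[R]_n) (V : {vspace 'cV[R]_n}) :
  V != 0%VS -> mx_invariant M V -> stable_on T M V ->
  exists a b (f1 f2 : 'rV[R]_n), [/\ stable_point T a b,
    (exists2 v, v \in V & ~~ ((f1 *m v == 0) && (f2 *m v == 0))),
    {in V, forall v, f1 *m (M *m v) = a *: (f1 *m v) - b *: (f2 *m v)} &
    {in V, forall v, f2 *m (M *m v) = b *: (f1 *m v) + a *: (f2 *m v)}].
Proof.
move=> V0 MV /(stable_onP T MV) hs.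
have d0 : (0 < \dim V)%N by rewrite lt0n dimv_eq0.
have [a [b hab]] := complexify_eigenvalue (restriction_mx M V) d0.
have [B hB] := basis_mx_linv V.
have /spectrum_rowP[x [y [xy hx hy]]] := hab.
exists a, b, (x *m B), (y *m B); split.
- exact/stability_regionE/hs.
- have [i hi] : exists i, (x 0 i != 0) || (y 0 i != 0).
    by case/orP: xy => /rV0Pn[i hi]; exists i; rewrite hi ?orbT.
  exists (basis_mx V *m delta_mx i 0); first exact: basis_mx_mem.
  rewrite !mulmxA -(mulmxA x) -(mulmxA y) hB !mulmx1 -!colE negb_and.
  apply: contraTT hi; rewrite !negb_or !negbK => /andP[/eqP h1 /eqP h2].
  have := congr1 (fun M : 'M[R]_1 => M 0 0) h1.
  have := congr1 (fun M : 'M[R]_1 => M 0 0) h2.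
  by rewrite !mxE => -> ->; rewrite eqxx.
- move=> _ /basis_mxP[c ->]; rewrite (mulmxA M) restriction_mxE // !mulmxA.
  by rewrite -!(mulmxA _ B) hB !mulmx1 hx mulmxBl -!scalemxAl.
- move=> _ /basis_mxP[c ->]; rewrite (mulmxA M) restriction_mxE // !mulmxA.
  by rewrite -!(mulmxA _ B) hB !mulmx1 hy mulmxDl -!scalemxAl.
Qed.

Variables (n m p : nat) (Sigma : lti_system R n m p).
Implicit Types (V W : {vspace 'cV[R]_n}) (F : 'M[R]_(m, n)).

Definition stably_nulling V F : Prop :=
  output_nulling Sigma V F /\ stable_on T (closed_loop Sigma F) V.

Lemma stably_nullingE V F : stably_nulling V F <->
  output_nulling Sigma V F /\
  spectrum (restriction_mx (closed_loop Sigma F) V) `<=` stability_region T.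
Proof.
by split=> -[hV]; have [MV _] := hV; move/(stable_onP T MV).
Qed.

(* On a minimal invariant subspace [V2] of [W] not contained in [V], the squared
   modulus of a complex left eigenvector is a quadratic form whose radical lies
   in [V]; applying [G] only on the orthogonal complement of [V :&: V2] in [V2]
   keeps the quotient stable. *)
Lemma stably_nulling_grow V W F G :
  stably_nulling V F -> stably_nulling W G -> ~~ (W <= V)%VS ->
  exists V' H, [/\ stably_nulling V' H, (V <= V')%VS & ~~ (V' <= V)%VS].
Proof.
move=> [/output_nullingP hV sV] [hWn sW] nWV.
have hW := (output_nullingP _ _ _).1 hWn.
set M := closed_loop Sigma G in sW hW.
have /exists_min_dim[V2 [[V2W MV2 nV2V] minV2]] : [set U | [/\ (U <= W)%VS,
    mx_invariant M U & ~~ (U <= V)%VS]] W.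
  by split=> //; case: hWn.
have V20 : V2 != 0%VS by apply: contraNneq nV2V => ->; apply: sub0v.
have [a [b [f1 [f2 [sab [v0 v0V2 hv0] hf1 hf2]]]]] :=
  left_eigenfunctional V20 MV2 (stable_on_sub V2W sW).
pose Phi := col_mx f1 f2.
pose N := (V2 :&: lker (mxfun Phi))%VS.
have PhiE (v : 'cV_n) : (Phi *m v == 0) = (f1 *m v == 0) && (f2 *m v == 0).
  by rewrite mul_col_mx col_mx_eq0.
have memN v : (v \in N) = (v \in V2) && ((f1 *m v == 0) && (f2 *m v == 0)).
  by rewrite memv_cap memv_lker_mx PhiE.
(* [N] is [M]-invariant because [f1] and [f2] span an invariant pair of forms on [V2], and it misses
   [v0]. Minimality of [V2] leaves only inclusion in [V]. *)
have NV : (N <= V)%VS.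
  apply: contraT => nNV.
  suff /minV2 : [set U | [/\ (U <= W)%VS, mx_invariant M U & ~~ (U <= V)%VS]] N.
    have : (N <= V2)%VS by apply: capvSl.
    rewrite leqNgt => NV2; rewrite (ltn_leqif (dimv_leqif_sup NV2)).
    by move=> /negbNE/subvP/(_ _ v0V2); rewrite memN (negPf hv0) andbF.
  split=> //; first exact: subv_trans (capvSl _ _) V2W.
  apply/mx_invariantP => v; rewrite !memN => /and3P[vV2 /eqP h1 /eqP h2].
  rewrite (mx_invariantP _ _).1 //= hf1 // hf2 // h1 h2 !scaler0.
  by rewrite subr0 addr0 eqxx.
pose U := (V :&: V2)%VS.
pose Lp := (V2 :&: lker (mxfun ((Phi *m basis_mx U)^T *m Phi)))%VS.
have LpP v u : v \in Lp -> u \in U -> (Phi *m u)^T *m (Phi *m v) = 0.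
  rewrite memv_cap memv_lker_mx => /andP[_ /eqP h] /basis_mxP[c ->].
  rewrite (mulmxA Phi) [(_ *m c)^T]trmx_mul -mulmxA.
  by rewrite (mulmxA (Phi *m _)^T) h mulmx0.
have LpI v : v \in V2 -> {in U, forall u, (Phi *m u)^T *m (Phi *m v) = 0} ->
    v \in Lp.
  move=> vV2 h; rewrite memv_cap vV2 memv_lker_mx.
  apply/eqP/row_matrixP => i; rewrite row0 rowE.
  have := h (basis_mx U *m delta_mx i 0) (basis_mx_mem _).
  by rewrite (mulmxA Phi) [(_ *m delta_mx _ _)^T]trmx_mul trmx_delta !mulmxA.
(* [Lp] contains the radical [N], which lies in [V]; splitting it off makes the form definite on [L]
   and [L] independent of [V]. *)
pose L := (Lp :\: N)%VS.
have LLp : (L <= Lp)%VS by apply: diffvSl.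
have LpV2 : (Lp <= V2)%VS by apply: capvSl.
have VL : (V :&: L = 0)%VS.
  apply/eqP; rewrite -subv0; apply/subvP => l /memv_capP[lV lL].
  have lLp := subvP LLp _ lL; have lV2 := subvP LpV2 _ lLp.
  have lU : l \in U by rewrite memv_cap lV.
  have lN : l \in N.
    rewrite memv_cap lV2 memv_lker_mx.
    have /matrixP/(_ 0 0) := LpP _ _ lLp lU.
    rewrite [LHS]mxE [RHS]mxE => /psumr_eq0P h.
    apply/eqP/matrixP => i j; rewrite ord1 [RHS]mxE.
    apply/eqP; rewrite -sqrf_eq0; apply/eqP.
    have := h _ i isT; rewrite [_^T _ _]mxE -expr2; apply.
    by move=> k _; rewrite [_^T _ _]mxE -expr2 sqr_ge0.
  by rewrite -(capv_diff Lp N) memv_cap lL.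
(* Subtracting a projection onto [U] leaves a vector of [Lp], a sum of parts in [L] and in [N]; the
   latter is absorbed by [U]. *)
have V2UL : (V2 <= U + L)%VS.
  apply/subvP => v vV2; have [u uU hu] := semidefinite_projection Phi U v.
  have uV2 : u \in V2 by move: uU; rewrite memv_cap => /andP[].
  have vuLp : v - u \in Lp by apply: LpI; rewrite ?rpredB.
  have : v - u \in (L + N)%VS.
    by rewrite addv_diff; apply: subvP vuLp; apply: addvSl.
  case/memv_addP => l lL [k kN hlk].
  rewrite -(subrK u v) hlk -addrA [l + _]addrC; apply: memv_add => //.
  rewrite rpredD // memv_cap (subvP NV _ kN) /=.
  by move: kN; rewrite memv_cap => /andP[].
have [H [HV HL]] := glue_feedback F G VL.
have UV : (U <= V)%VS by apply: capvSl.
have hH x l : x \in V -> l \in L -> exists u k, [/\ u \in U, k \in L,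
    M *m l = u + k,
    closed_loop Sigma H *m (x + l) = (closed_loop Sigma F *m x + u) + k &
    closed_output Sigma H *m (x + l) = 0].
  move=> xV lL; have lV2 := subvP LpV2 _ (subvP LLp _ lL).
  have MlV2 : M *m l \in V2 by apply: (mx_invariantP _ _).1.
  have /memv_addP[u uU [k kL huk]] := subvP V2UL _ MlV2.
  exists u, k; split=> //.
    by rewrite mulmxDr closed_loopE HV // closed_loopE HL // -!closed_loopE
      -/M huk addrA.
  rewrite mulmxDr closed_outputE HV // closed_outputE HL // -!closed_outputE.
  by rewrite (hV _ xV).2 (hW _ (subvP V2W _ lV2)).2 addr0.
exists (V + L)%VS, H; split; last 2 first.
- exact: addvSl.
- apply: contra nV2V => /(subv_trans _) -> //.
  by apply: subv_trans V2UL _; apply: addvS.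
split.
  apply/output_nullingP => _ /memv_addP[x xV [l lL ->]].
  have [u [k [uU kL _ -> ->]]] := hH x l xV lL; split=> //.
  by apply: memv_add => //; rewrite rpredD ?(subvP UV _ uU) //; case: (hV _ xV).
move=> _ _ a' b' /memv_addP[x xV [l lL ->]] /memv_addP[y yV [k kL ->]] xy.
have [ux [mx [uxU mxL hMl -> _]]] := hH x l xV lL.
have [uy [my [uyU myL hMk -> _]]] := hH y k yV kL.
have Fx : closed_loop Sigma F *m x + ux \in V.
  by rewrite rpredD ?(subvP UV _ uxU) //; case: (hV _ xV).
have Fy : closed_loop Sigma F *m y + uy \in V.
  by rewrite rpredD ?(subvP UV _ uyU) //; case: (hV _ yV).
have e1 : a' *: (x + l) - b' *: (y + k) =
    (a' *: x - b' *: y) + (a' *: l - b' *: k).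
  by rewrite !scalerDr opprD addrACA.
have e2 : b' *: (x + l) + a' *: (y + k) =
    (b' *: x + a' *: y) + (b' *: l + a' *: k).
  by rewrite !scalerDr addrACA.
rewrite e1 e2 => h1 h2.
(* The [L]-components of the eigenvector equations: [a'] and [b'] belong to the compression of [M]
   to [L]. If these components vanish, the eigenvector lies in [V], where [F] is already stable. *)
have hmx : mx = a' *: l - b' *: k.
  by apply: capv0_decomp VL Fx _ mxL _ h1; rewrite rpredB ?rpredZ.
have hmy : my = b' *: l + a' *: k.
  by apply: capv0_decomp VL Fy _ myL _ h2; rewrite rpredD ?rpredZ.
have [/andP[/eqP l0 /eqP k0]|lk0] := boolP ((l == 0) && (k == 0)).
  have Ml0 : 0 = ux + mx by rewrite -hMl l0 mulmx0.
  have Mk0 : 0 = uy + my by rewrite -hMk k0 mulmx0.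
  have mx0 : mx = 0 by rewrite hmx l0 k0 !scaler0 subr0.
  have my0 : my = 0 by rewrite hmy l0 k0 !scaler0 addr0.
  have ux0 : ux = 0 by rewrite Ml0 mx0 addr0.
  have uy0 : uy = 0 by rewrite Mk0 my0 addr0.
  move: h1 h2 xy; rewrite mx0 my0 ux0 uy0 l0 k0 !(scaler0, addr0, subr0).
  by move=> h1 h2 xy; apply: (sV x y).
have lV2 := subvP LpV2 _ (subvP LLp _ lL).
have kV2 := subvP LpV2 _ (subvP LLp _ kL).
have LpQ u v : u \in U -> v \in L ->
   (f1 *m u) 0 0 * (f1 *m v) 0 0 + (f2 *m u) 0 0 * (f2 *m v) 0 0 = 0.
  move=> uU /(subvP LLp) vLp; have /matrixP/(_ 0 0) := LpP _ _ vLp uU.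
  by rewrite !mul_col_mx tr_col_mx mul_row_col !mxE !big_ord1 !mxE.
have app M1 M2 : M1 = M2 -> (M1 : 'M[R]_1) 0 0 = M2 0 0 by move=> ->.
have g1 := app _ _ (hf1 _ lV2); have g2 := app _ _ (hf2 _ lV2).
have g3 := app _ _ (hf1 _ kV2); have g4 := app _ _ (hf2 _ kV2).
rewrite hMl hmx in g1 g2; rewrite hMk hmy in g3 g4.
have Lx0 z : z \in L -> (f1 *m z == 0) && (f2 *m z == 0) -> z = 0.
  move=> zL hz; apply/eqP; rewrite -memv0 -(capv_diff Lp N) memv_cap zL memN hz.
  by rewrite (subvP LpV2 _ (subvP LLp _ zL)).
have mx1 (z : 'M[R]_1) : z 0 0 = 0 -> z == 0.
  by move=> h; apply/eqP/matrixP => i j; rewrite !ord1 h mxE.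
apply: (@compression_stable _ T a b a' b' ((f1 *m l) 0 0) ((f2 *m l) 0 0)
  ((f1 *m k) 0 0) ((f2 *m k) 0 0) ((f1 *m ux) 0 0) ((f2 *m ux) 0 0)
  ((f1 *m uy) 0 0) ((f2 *m uy) 0 0)) => //; last 4 first.
- by move: g1; rewrite !mulmxDr mulmxN -!scalemxAr !mxE.
- by move: g2; rewrite !mulmxDr mulmxN -!scalemxAr !mxE.
- by move: g3; rewrite !mulmxDr -!scalemxAr !mxE.
- by move: g4; rewrite !mulmxDr -!scalemxAr !mxE.
- rewrite lt_def !addr_ge0 ?sqr_ge0 // andbT; apply: contra lk0.
  rewrite !paddr_eq0 ?addr_ge0 ?sqr_ge0 // !sqrf_eq0.
  case/andP => /andP[/eqP/mx1 q1 /eqP/mx1 q2] /andP[/eqP/mx1 q3 /eqP/mx1 q4].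
  have -> : l = 0 by apply: Lx0; rewrite // q1 q2.
  have -> : k = 0 by apply: Lx0; rewrite // q3 q4.
  by rewrite eqxx.
- exact: LpQ.
- exact: LpQ.
- exact: LpQ.
- exact: LpQ.
Qed.

Let Pg := [set V | exists F, output_nulling Sigma V F /\
    spectrum (restriction_mx (closed_loop Sigma F) V) `<=` stability_region T].

Let Pg0 : Pg 0%VS.
Proof.
exists 0; apply/stably_nullingE; split; first exact: output_nulling0.
move=> x y a b; rewrite !memv0 => /eqP -> /eqP ->.
by rewrite eqxx.
Qed.

Lemma Vgstar_nulling : exists F, stably_nulling (Vgstar T Sigma) F.
Proof.
by have [F /stably_nullingE hF] := largest_mem Pg0; exists F.
Qed.

Lemma Vgstar_sup V F : stably_nulling V F -> (V <= Vgstar T Sigma)%VS.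
Proof.
move=> hV; apply: (largest_sup Pg0); last by exists F; apply/stably_nullingE.
move=> {F hV} U W [F /stably_nullingE hU] [G /stably_nullingE hW] nWU.
have [V' [H [hV' UV' nV'U]]] := stably_nulling_grow hU hW nWU.
by exists V'; split=> //; exists H; apply/stably_nullingE.
Qed.

End StablyNulling.

(** * Reachability subspaces *)

Section Reachability.
Variable R : realType.

Lemma is_smallest_exists (vT : vectType R) (P : set {vspace vT}) :
  P fullv -> (forall V W, P V -> P W -> P (V :&: W)%VS) ->
  exists W, is_smallest P W.
Proof.
move=> Pf PI; have [V [PV minV]] := exists_min_dim Pf.
exists V; split=> // W PW.
have := eqEdim (V :&: W)%VS V; rewrite capvSl minV; last exact: PI.
by move=> /eqP <-; apply: capvSr.
Qed.

Lemma dim_cV n : \dim {: 'cV[R]_n} = n.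
Proof. by rewrite dimvf dim_matrix; apply: muln1. Qed.

(** An injective map sends an invariant finite-dimensional subspace onto itself. *)
Lemma unitmx_preimage n (N : 'M[R]_n) (U : {vspace 'cV[R]_n}) v :
  N \in unitmx -> mx_invariant N U -> N *m v \in U -> v \in U.
Proof.
move=> uN iN hv.
have inj : lker (mxfun N) = 0%VS.
  apply/eqP; rewrite -subv0; apply/subvP => x; rewrite memv_lker_mx memv0.
  by move/eqP => h; rewrite -(mulKmx uN x) h mulmx0.
have : (mxfun N @: U)%VS = U.
  apply/eqP; rewrite eqEdim iN -[leqLHS](limg_ker_dim (mxfun N) U) inj capv0.
  by rewrite dimv0 add0n leqnn.
move=> h; move: hv; rewrite -{1}h => /memv_imgP[u uU]; rewrite mxfunE => e.
by rewrite -(mulKmx uN v) e mulKmx.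
Qed.

Lemma unitmx_sub_scalar n (M : 'M[R]_n) (mu : R) :
  ~~ root (char_poly M) mu -> M - mu%:M \in unitmx.
Proof.
rewrite -eigenvalue_root_char /eigenvalue negbK /eigenspace => /eqP h.
by rewrite -row_free_unit -kermx_eq0 h.
Qed.

Lemma char_poly_neq0 n (M : 'M[R]_n) : char_poly M != 0.
Proof. exact/monic_neq0/char_poly_monic. Qed.

(** For invertible [M - mu%:M], these are the states that [M - mu%:M] maps into [U]: an input with
    effect in [U] turns them into eigenvectors for [mu]. *)
Definition resolvent_image n (M : 'M[R]_n) (U : {vspace 'cV[R]_n}) mu :=
  (mxfun (invmx (M - mu%:M)) @: U)%VS.

Lemma resolvent_imageP n (M : 'M[R]_n) (U : {vspace 'cV[R]_n}) mu v :
  v \in resolvent_image M U mu ->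
  exists2 b, b \in U & v = invmx (M - mu%:M) *m b.
Proof. by case/memv_imgP => b bU ->; exists b; rewrite // mxfunE. Qed.

(* If the image under the resolvent at [mu] brings nothing new, then the
   resolvent identity makes the span of the previous images invariant. *)
Lemma resolvent_span n (M : 'M[R]_n) (U : {vspace 'cV[R]_n}) (s : seq R) :
  uniq s -> (n < size s)%N -> {in s, forall mu, M - mu%:M \in unitmx} ->
  exists W, [/\ mx_invariant M W, (U <= W)%VS &
    (W <= \sum_(mu <- s) resolvent_image M U mu)%VS].
Proof.
move=> us szs hs.
set J := resolvent_image M U.
(* Either some image brings nothing new, or each rate adds a dimension; more than [n] rates exclude
   the latter. *)
suff [//|/leq_trans] : (exists W, [/\ mx_invariant M W, (U <= W)%VS &
    (W <= \sum_(mu <- s) J mu)%VS]) \/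
    (size s <= \dim (\sum_(mu <- s) J mu)%VS)%N.
  have /dimvS : (\sum_(mu <- s) J mu <= fullv)%VS by apply: subvf.
  rewrite dim_cV => h /(_ _ h).
  by rewrite leqNgt szs.
elim: s {szs} us hs => [|mu s IH] /= => [_ _|/andP[mus us] hs]; first by right.
have hs' : {in s, forall nu, M - nu%:M \in unitmx}.
  by move=> nu nus; apply: hs; rewrite inE nus orbT.
rewrite big_cons; set W := (\sum_(nu <- s) J nu)%VS in IH *.
case: (IH us hs') => [[W' [iW' UW' W'W]]|dW].
  left; exists W'; split=> //; exact: subv_trans W'W (addvSr _ _).
have [JW|nJW] := boolP (J mu <= W)%VS; last first.
  right; apply: leq_ltn_trans dW _.
  rewrite (ltn_leqif (dimv_leqif_sup (addvSr _ _))) subv_add negb_and.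
  by rewrite nJW.
have uN : M - mu%:M \in unitmx by apply: hs; rewrite inE eqxx.
set N := M - mu%:M in uN *.
have uN' : invmx N \in unitmx by rewrite unitmx_inv.
have iW : mx_invariant (invmx N) W.
  apply/mx_invariantP => v; rewrite -mxfunE memv_preim; apply/subvP: v.
  have JWs nu : nu \in s -> (J nu <= W)%VS.
    by move=> nus; rewrite /W (big_rem nu) //=; apply: addvSl.
  rewrite {1}/W big_seq; elim/big_ind: _ => [|V1 V2 h1 h2|nu nus].
  - exact: sub0v.
  - by rewrite subv_add h1.
  apply/subvP => v vJ; rewrite -memv_preim mxfunE.
  have vW := subvP (JWs _ nus) _ vJ.
  have [b bU vb] := resolvent_imageP vJ.
  have munu : mu - nu != 0.
    by rewrite subr_eq0; apply: contraNneq mus => ->.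
  have uNnu : M - nu%:M \in unitmx by apply: hs'.
  have key : (mu - nu) *: (invmx N *m v) = invmx N *m b - v.
    rewrite -[v in RHS](mulKmx uN) -mulmxBr -(mulKVmx uNnu b) -vb -mulmxBl.
    by rewrite /N opprD opprK addrACA subrr add0r addrC -raddfB /= mul_scalar_mx
      scalemxAr.
  rewrite -(scalerK munu (_ *m v)) key; apply/rpredZ/rpredB => //.
  by apply: (subvP JW); rewrite /J /resolvent_image -mxfunE memv_img.
left; exists W; split; last exact: addvSr.
  apply/mx_invariantP => v vW.
  have NvW : N *m v \in W by apply: unitmx_preimage uN' iW _; rewrite mulKmx.
  have -> : M *m v = N *m v + mu *: v.
    by rewrite mulmxBl mul_scalar_mx subrK.
  by rewrite rpredD ?rpredZ.
apply/subvP => b bU; apply: unitmx_preimage uN' iW _.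
apply: (subvP JW); rewrite /J /resolvent_image -mxfunE; exact: memv_img.
Qed.

Variables (n m p : nat) (Sigma : lti_system R n m p).

(** The state part of a kernel vector of the Rosenbrock matrix at the real point [mu]. *)
Definition eigen_direction mu (v : 'cV[R]_n) : Prop :=
  exists w, Amx Sigma *m v + Bmx Sigma *m w = mu *: v /\
            Cmx Sigma *m v + Dmx Sigma *m w = 0.

Let BkerD := (mxfun (Bmx Sigma) @: lker (mxfun (Dmx Sigma)))%VS.

Lemma memv_BkerD b : reflect
  (exists2 u, b = Bmx Sigma *m u & Dmx Sigma *m u = 0) (b \in BkerD).
Proof.
apply: (iffP memv_imgP) => -[u].
  by rewrite memv_lker_mx mxfunE => /eqP ? ?; exists u.
by move=> hb hu; exists u; rewrite ?memv_lker_mx ?hu ?mxfunE.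
Qed.

Lemma Rstar_smallest : exists F, output_nulling Sigma (Vstar Sigma) F /\
  is_smallest [set U | mx_invariant (closed_loop Sigma F) U /\
    (Vstar Sigma :&: BkerD <= U)%VS] (Rstar Sigma).
Proof.
have [F hF] := Vstar_nulling Sigma.
have [W hW] : exists W, is_smallest [set U |
    mx_invariant (closed_loop Sigma F) U /\ (Vstar Sigma :&: BkerD <= U)%VS] W.
  apply: is_smallest_exists.
    by split; [apply/mx_invariantP => v _; apply: memvf|apply: subvf].
  move=> V W [/mx_invariantP iV hV] [/mx_invariantP iW hW]; split.
    apply/mx_invariantP => v; rewrite !memv_cap => /andP[vV vW].
    by rewrite iV ?iW.
  by rewrite subv_cap hV.
pose P := [set W | exists F, output_nulling Sigma (Vstar Sigma) F /\
  is_smallest [set U | mx_invariant (closed_loop Sigma F) U /\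
    (Vstar Sigma :&: BkerD <= U)%VS] W].
have : P (xget 0%VS P) by apply: xgetPex; exists W, F.
by [].
Qed.

Lemma mx_invariant_sub_scalar k (M : 'M[R]_k) (U : {vspace 'cV[R]_k}) mu :
  mx_invariant M U -> mx_invariant (M - mu%:M) U.
Proof.
move=> /mx_invariantP h; apply/mx_invariantP => v vU.
by rewrite mulmxBl mul_scalar_mx rpredB ?rpredZ ?h.
Qed.

(** The line through [v] is output-nulling, so [v] lies in [Vstar]. For a friend F, (A + BF - mu) v
    = B (F v - w) with F v - w in ker D, so the image of [v] lies in the reachability subspace;
    inverting A + BF - mu there brings [v] back into it. *)
Lemma eigen_direction_Rstar : exists q : {poly R}, q != 0 /\
  forall mu v, ~~ root q mu -> eigen_direction mu v -> v \in Rstar Sigma.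
Proof.
have [F [hF [[iR BR] _]]] := Rstar_smallest.
exists (char_poly (closed_loop Sigma F)); split; first exact: char_poly_neq0.
move=> mu v /unitmx_sub_scalar uN [w [hA hC]].
have [->|v0] := eqVneq v 0; first exact: mem0v.
have vV : v \in Vstar Sigma.
  have [|H [_ Hv]] := extend_feedback (V := 0%VS) 0 w (v := v).
    by rewrite memv0.
  apply: (subvP (Vstar_sup (V := <[v]>%VS) (F := H) _)); last exact: memv_line.
  apply/output_nullingP => _ /vlineP[k ->].
  rewrite -!scalemxAr closed_loopE closed_outputE Hv hA hC scaler0; split=> //.
  by rewrite !rpredZ // memv_line.
have [h1 h2] := (output_nullingP _ _ _).1 hF _ vV.
apply: unitmx_preimage uN (mx_invariant_sub_scalar mu iR) _.
apply: (subvP BR); rewrite memv_cap; apply/andP; split.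
  by rewrite mulmxBl mul_scalar_mx rpredB ?rpredZ.
apply/memv_BkerD; exists (F *m v - w).
  by rewrite mulmxBl mul_scalar_mx closed_loopE -hA mulmxBr opprD addrACA subrr
    add0r.
suff e : Dmx Sigma *m (F *m v) = Dmx Sigma *m w by rewrite mulmxBr e subrr.
by apply: (addrI (Cmx Sigma *m v)); rewrite -closed_outputE h2 hC.
Qed.

Lemma Rstar_eigen_span : exists q : {poly R}, q != 0 /\
  forall s, uniq s -> (n < size s)%N -> {in s, forall mu, ~~ root q mu} ->
  exists X : seq 'cV[R]_n, (Rstar Sigma <= <<X>>)%VS /\
    {in X, forall v, exists2 mu, mu \in s & eigen_direction mu v}.
Proof.
have [F [hF [_ minR]]] := Rstar_smallest.
set M := closed_loop Sigma F in minR *.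
exists (char_poly M); split; first exact: char_poly_neq0.
move=> s us szs hs.
pose J := resolvent_image M (Vstar Sigma :&: BkerD)%VS.
have us' : {in s, forall mu, M - mu%:M \in unitmx}.
  by move=> mu /hs; apply: unitmx_sub_scalar.
have [W [iW BW WJ]] := resolvent_span (Vstar Sigma :&: BkerD) us szs us'.
exists (flatten [seq tval (vbasis (J mu)) | mu <- s]); split.
  apply: subv_trans (minR W (conj iW BW)) (subv_trans WJ _).
  elim: (s) => [|mu s' IH] /=; first by rewrite big_nil sub0v.
  rewrite big_cons span_cat; apply: addvS => //.
  by rewrite (span_basis (vbasisP _)).
move=> v /flatten_mapP[mu mus /vbasis_mem vJ]; exists mu => //.
have [b bVB vb] := resolvent_imageP vJ.
move: bVB; rewrite memv_cap => /andP[bV /memv_BkerD[u bu Du]].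
have Nv : (M - mu%:M) *m v = b by rewrite vb mulKVmx ?us'.
have iV : mx_invariant M (Vstar Sigma) by case: hF.
have vV : v \in Vstar Sigma.
  apply: unitmx_preimage (us' _ mus) (mx_invariant_sub_scalar mu iV) _.
  by rewrite Nv.
have [_ h2] := (output_nullingP _ _ _).1 hF _ vV.
(* Here (M - mu) v = B u with D u = 0, so removing [u] from the friend's input leaves mu v and does
   not change the output. *)
exists (F *m v - u); rewrite !mulmxBr !addrA -closed_loopE -closed_outputE.
rewrite -bu Du h2 subr0; split=> //.
by apply/eqP; rewrite subr_eq addrC -subr_eq -Nv mulmxBl mul_scalar_mx.
Qed.

End Reachability.

(** * Rado's theorem and the construction of the feedback *)

Section Rado.
Variables (K : fieldType) (vT : vectType K) (I : finType) (V : {vspace vT}).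
Implicit Types (U : I -> {vspace vT}) (S : {set I}).

(** Rado's condition in the quotient by [V]. When every member is a line, it says that the
    generators are linearly independent modulo [V]. *)
Definition rado_condition U : Prop :=
  forall S, (\dim V + #|S| <= \dim (V + \sum_(j in S) U j)%VS)%N.

Definition replace U i X : I -> {vspace vT} :=
  fun j => if j == i then X else U j.

Lemma sum_replace_notin U i X S : i \notin S ->
  (\sum_(j in S) replace U i X j = \sum_(j in S) U j)%VS.
Proof.
move=> iS; apply: eq_bigr => j jS; rewrite /replace.
by case: eqP jS iS => // -> ->.
Qed.

Lemma sum_replace_in U i X S : i \in S ->
  (\sum_(j in S) replace U i X j = X + \sum_(j in S :\ i) U j)%VS.
Proof.
move=> iS; rewrite (big_setD1 i) //= {1}/replace eqxx; congr addv.
by rewrite sum_replace_notin // in_setD1 eqxx.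
Qed.

Lemma rado_replace_fail U i X : rado_condition U ->
  ~ rado_condition (replace U i X) ->
  exists2 S : {set I}, i \in S &
    (\dim (V + (X + \sum_(j in S :\ i) U j))%VS < \dim V + #|S|)%N.
Proof.
move=> hU /existsNP[S /negP]; rewrite -ltnNge => hS.
have iS : i \in S.
  by apply: contraTT hS => iS; rewrite sum_replace_notin // -leqNgt.
by exists S => //; rewrite -sum_replace_in.
Qed.

(* Uncrossing by submodularity of the dimension. *)
Lemma rado_split U i X Y : U i = (X + Y)%VS -> rado_condition U ->
  rado_condition (replace U i X) \/ rado_condition (replace U i Y).
Proof.
move=> Ui hU; apply: contrapT => /not_orP[hX hY].
have [S iS hS] := rado_replace_fail hU hX.
have [S' iS' hS'] := rado_replace_fail hU hY.
set PX := (V + _)%VS in hS; set PY := (V + _)%VS in hS'.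
have XP : (X <= PX)%VS := subv_trans (addvSl _ _) (addvSr _ _).
have YP : (Y <= PY)%VS := subv_trans (addvSl _ _) (addvSr _ _).
have VX : (V <= PX)%VS := addvSl _ _.
have VY : (V <= PY)%VS := addvSl _ _.
have SX j : j \in S -> j != i -> (U j <= PX)%VS.
  move=> jS ji; apply: subv_trans (addvSr _ _).
  by apply: subv_trans (addvSr _ _); apply: (sumv_sup j); rewrite // in_setD1 ji.
have SY j : j \in S' -> j != i -> (U j <= PY)%VS.
  move=> jS ji; apply: subv_trans (addvSr _ _).
  by apply: subv_trans (addvSr _ _); apply: (sumv_sup j); rewrite // in_setD1 ji.
have h1 : (V + \sum_(j in S :|: S') U j <= PX + PY)%VS.
  rewrite subv_add (subv_trans VX (addvSl _ _)) /=; apply/subv_sumP => j.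
  have [-> _|ji] := eqVneq j i; first by rewrite Ui addvS.
  by rewrite inE => /orP[/SX|/SY]/(_ ji) h;
    [apply: subv_trans h (addvSl _ _)|apply: subv_trans h (addvSr _ _)].
have h2 : (V + \sum_(j in (S :&: S') :\ i) U j <= PX :&: PY)%VS.
  rewrite subv_add subv_cap VX VY /=; apply/subv_sumP => j.
  by rewrite !inE => /and3P[ji jS jS']; rewrite subv_cap SX ?SY.
(* The lower bounds add up to 2 dim V + |S| + |S'| - 1, because [i] is dropped from the intersection
   only; the two strict failures allow at most 2 dim V + |S| + |S'| - 2. *)
have := leq_trans (hU _) (dimvS h1); have := leq_trans (hU _) (dimvS h2).
have := dimv_sum_cap PX PY; have := cardsUI S S'.
rewrite (cardsD1 i (S :&: S')) inE iS iS' /=.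
by move: hS hS'; lia.
Qed.

(** Lines are split off the list one by one; the condition for the singleton of [i] prevents the
    list from running out. *)
Lemma rado_condition_pick1 U i (X : seq vT) : U i = <<X>>%VS ->
  rado_condition U ->
  exists2 x, x \in X & rado_condition (replace U i <[x]>).
Proof.
elim: X U => [|x X IH] U Ui hU.
  have := hU [set i]%SET; rewrite big_set1 Ui span_nil addv0 cards1 addn1.
  by rewrite ltnn.
rewrite span_cons in Ui; have [h|h] := rado_split Ui hU.
  by exists x; rewrite // inE eqxx.
have [|y yX hy] := IH _ _ h; first by rewrite /replace eqxx.
exists y; first by rewrite inE yX orbT.
congr (rado_condition _): hy; apply/funext => j.
by rewrite /replace; case: eqP.
Qed.

(** The representatives have to come from given generators, not merely from the subspaces: being an
    eigendirection is a property of the generators that sums over different rates lose. *)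
Lemma rado_condition_pick U (X : I -> seq vT) :
  (forall i, U i <= <<X i>>)%VS -> rado_condition U ->
  exists x : I -> vT, (forall i, x i \in X i) /\
    rado_condition (fun i => <[x i]>%VS).
Proof.
move=> UX hU.
have hX : rado_condition (fun i => <<X i>>%VS).
  move=> S; apply: leq_trans (hU S) (dimvS _); apply: addvS => //.
  by apply/subv_sumP => j jS; apply: (sumv_sup j).
suff h (s : seq I) : exists x : I -> vT, {in s, forall i, x i \in X i} /\
    rado_condition (fun i => if i \in s then <[x i]>%VS else <<X i>>%VS).
  have [x [xX hx]] := h (enum I); exists x; split=> [i|].
    by apply: xX; rewrite mem_enum.
  congr (rado_condition _): hx; apply/funext => j.
  by rewrite mem_enum.
elim: s => [|i s [x [xX hx]]]; first by exists (fun=> 0).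
have [is_|nis] := boolP (i \in s).
  exists x; split=> [j|]; first by rewrite inE => /predU1P[->|]; apply: xX.
  congr (rado_condition _): hx; apply/funext => j.
  by rewrite inE; case: eqP => // ->; rewrite is_.
have [|y yX hy] := rado_condition_pick1 (i := i) (X := X i) _ hx.
  by rewrite (negPf nis).
exists (fun j => if j == i then y else x j); split=> [j|].
  by rewrite inE; case: eqP => [->|_] //= /xX.
congr (rado_condition _): hy; apply/funext => j.
by rewrite /replace inE; case: eqP.
Qed.

Lemma rado_lines_notin (x : I -> vT) i s :
  rado_condition (fun i => <[x i]>%VS) -> uniq (i :: s) ->
  x i \notin (V + \sum_(j <- s) <[x j]>)%VS.
Proof.
move=> hx uis; have /andP[_ us] := uis.
have hs : (\dim (V + \sum_(j <- s) <[x j]>)%VS <= \dim V + size s)%N.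
  apply: leq_trans (dimv_add_leqif _ _) _; rewrite leq_add2l.
  apply: leq_trans (dimv_leq_sum _ _ _) _.
  rewrite -sum1_size; apply: leq_sum => j _.
  by rewrite dim_vline leq_b1.
apply: contraTN hs => xi; rewrite -ltnNge.
have := hx [set j in i :: s]%SET.
under eq_bigl do rewrite inE.
rewrite -big_uniq // cardsE (card_uniqP uis) /= addnS big_cons.
rewrite addvA (addvC V) -addvA.
suff -> : (<[x i]> + (V + \sum_(j <- s) <[x j]>) =
           V + \sum_(j <- s) <[x j]>)%VS by [].
by apply/addv_idPr; rewrite -memvE.
Qed.

End Rado.

Section Sufficiency.
Variables (R : realType) (T : time_domain) (n m p : nat).
Variables (Sigma : lti_system R n m p) (rho : R).

(** Positivity in discrete time keeps the powers of [mu] from alternating in sign. *)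
Definition decay_rate (mu : R) : bool :=
  match T with
  | continuous_time => mu <= rho
  | discrete_time => (0 < mu) && (mu <= rho)
  end.

Lemma decay_rate_stable mu :
  admissible_rate T rho -> decay_rate mu -> stable_point T mu 0.
Proof.
rewrite /decay_rate /stable_point; case: T => /= [h1 h2|/andP[h0 h1]].
  exact: le_lt_trans h1.
move=> /andP[h2 h3]; rewrite expr0n addr0 expr2.
by rewrite mulr_ilt1 ?(ltW h2) ?(le_lt_trans h3).
Qed.

Lemma decay_rates_avoid (q : {poly R}) N : admissible_rate T rho -> q != 0 ->
  exists s : seq R, [/\ uniq s, (N <= size s)%N &
    {in s, forall mu, decay_rate mu && ~~ root q mu}].
Proof.
move=> hrho q0.
have [f fI hf] : exists2 f : nat -> R, injective f &
    forall k, decay_rate (f k).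
  rewrite /decay_rate; case: T hrho => /= [_|/andP[r0 r1]].
    exists (fun k => rho - k%:R) => [k l /addrI/oppr_inj/eqP|k].
      by rewrite eqr_nat => /eqP.
    by rewrite gerBl.
  exists (fun k => rho / k.+1%:R) => [k l|k].
    by move/(mulfI (lt0r_neq0 r0))/invr_inj/eqP; rewrite eqr_nat => /eqP[].
  by rewrite divr_gt0 ?ltr0Sn //= ler_pdivrMr ?ltr0Sn // ler_peMr ?(ltW r0) // ler1n.
(* Fewer than [size q] of these candidates are roots of [q], so at least [N] survive. *)
pose t := [seq f k | k <- iota 0 (N + size q)].
have ut : uniq t by rewrite map_inj_uniq ?iota_uniq.
exists [seq mu <- t | ~~ root q mu]; split.
- exact: filter_uniq.
- have szt : size t = (N + size q)%N by rewrite size_map size_iota.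
  have : (size [seq mu <- t | root q mu] < size q)%N.
    by apply: max_poly_roots; rewrite ?filter_uniq ?filter_all.
  have := count_predC (root q) t; rewrite szt !size_filter => h1 h2.
  have -> : count (fun mu => ~~ root q mu) t = count (predC (root q)) t by [].
  by rewrite -(leq_add2l (size q)) addnC -h1 leq_add2r ltnW.
- by move=> mu; rewrite mem_filter => /andP[-> /mapP[k _ ->]]; rewrite hf.
Qed.

Lemma remove_output_eq0 j (v : 'cV[R]_n) (w : 'cV[R]_m) :
  Cmx (remove_output Sigma j) *m v + Dmx (remove_output Sigma j) *m w = 0 <->
  forall i, i != j -> (Cmx Sigma *m v + Dmx Sigma *m w) i 0 = 0.
Proof.
have e i : (Cmx (remove_output Sigma j) *m v +
    Dmx (remove_output Sigma j) *m w) i 0 =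
    (Cmx Sigma *m v + Dmx Sigma *m w) (lift j i) 0.
  by rewrite !mxE; congr (_ + _); apply: eq_bigr => k _; rewrite !mxE.
split=> [h i ij|h].
  by case: (unliftP j i) ij => [k ->|->]; rewrite ?eqxx // -e h mxE.
by apply/matrixP => i k; rewrite ord1 e h ?mxE // eq_sym neq_lift.
Qed.

Lemma feedback_of_directions V F0 (x : 'I_p -> 'cV[R]_n)
    (w : 'I_p -> 'cV[R]_m) s :
  rado_condition V (fun j => <[x j]>%VS) -> uniq s ->
  exists F, {in V, forall v, F *m v = F0 *m v} /\
            {in s, forall j, F *m x j = w j}.
Proof.
move=> hx; elim: s => [_|j s IH us]; first by exists F0.
have /andP[js us'] := us.
have [F [FV Fs]] := IH us'.
have [H [HV Hx]] := extend_feedback F (w j) (rado_lines_notin hx us).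
exists H; split=> [v vV|i].
  by rewrite HV ?FV // (subvP (addvSl _ _)).
rewrite inE => /predU1P[-> //|is_]; rewrite HV ?Fs //.
apply: subvP (addvSr _ _) _ _; rewrite (big_rem i) //=.
exact: subvP (addvSl _ _) _ (memv_line _).
Qed.

Lemma eigenvector_stable M V (x : 'I_p -> 'cV[R]_n) (mu : 'I_p -> R) s :
  rado_condition V (fun j => <[x j]>%VS) -> uniq s ->
  mx_invariant M V -> stable_on T M V ->
  (forall j, M *m x j = mu j *: x j) -> (forall j, stable_point T (mu j) 0) ->
  mx_invariant M (V + \sum_(j <- s) <[x j]>)%VS /\
  stable_on T M (V + \sum_(j <- s) <[x j]>)%VS.
Proof.
move=> hx + iV sV Mx hmu; elim: s => [_|j s IH us].
  by rewrite big_nil addv0.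
have /andP[_ us'] := us; have [iW sW] := IH us'.
rewrite big_cons (addvC <[_]>%VS) addvA; split; last first.
  apply: (stable_on_line (mu := mu j)) => //.
    exact: rado_lines_notin hx us.
  by rewrite Mx subrr mem0v.
apply/mx_invariantP => _ /memv_addP[u uW [_ /vlineP[k ->] ->]].
rewrite mulmxDr -scalemxAr Mx; apply: memv_add.
  exact: (mx_invariantP _ _).1.
by rewrite !rpredZ // memv_line.
Qed.

Lemma exists_diagonalising_feedback :
  admissible_rate T rho -> (\dim (Vgstar T Sigma) + p = n)%N ->
  rado_condition (Vgstar T Sigma) (Rstar_without Sigma) ->
  exists F (mu : 'I_p -> R), [/\ asymptotically_stable T Sigma F,
    forall i, decay_rate (mu i) &
    forall i, row i (closed_output Sigma F) *m closed_loop Sigma F =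
              mu i *: row i (closed_output Sigma F)].
Proof.
move=> hrho dimV hR.
have hX j : exists X : seq 'cV[R]_n, (Rstar_without Sigma j <= <<X>>)%VS /\
    {in X, forall v, exists mu w, [/\ decay_rate mu,
      Amx Sigma *m v + Bmx Sigma *m w = mu *: v &
      forall i, i != j -> (Cmx Sigma *m v + Dmx Sigma *m w) i 0 = 0]}.
  have [q [q0 hq]] := Rstar_eigen_span (remove_output Sigma j).
  have [s [us szs hs]] := decay_rates_avoid n.+1 hrho q0.
  have [|X [RX hX]] := hq s us szs; first by move=> mu /hs/andP[].
  exists X; split=> // v /hX[mu /hs/andP[hmu _] [w [hA /remove_output_eq0 hC]]].
  by exists mu, w.
have [X {}hX] := boolp.choice hX.
have [x [xX hx]] := rado_condition_pick (fun j => (hX j).1) hR.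
have hx' j := (hX j).2 _ (xX j).
have [mu {}hx'] := boolp.choice hx'.
have [w {}hx'] := boolp.choice hx'.
have [F0 [hF0 sF0]] := Vgstar_nulling T Sigma.
have ue := enum_uniq 'I_p.
have [F [FV Fx]] := feedback_of_directions F0 w hx ue.
have {}Fx j : F *m x j = w j by apply: Fx; rewrite mem_enum.
have Mx j : closed_loop Sigma F *m x j = mu j *: x j.
  by rewrite closed_loopE Fx; case: (hx' j).
have hV v : v \in Vgstar T Sigma ->
    closed_loop Sigma F *m v \in Vgstar T Sigma /\
    closed_output Sigma F *m v = 0.
  by move=> vV; rewrite closed_loopE closed_outputE FV // -closed_loopE
    -closed_outputE; apply: (output_nullingP _ _ _).1.
have hdecay j : decay_rate (mu j) by case: (hx' j).
have [|||_ sF] := eigenvector_stable (M := closed_loop Sigma F) hx ue _ _ Mx.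
- by apply/mx_invariantP => v /hV[].
- by apply: stable_on_ext sF0 => v vV; rewrite !closed_loopE FV.
- by move=> j; apply: decay_rate_stable.
(* Rado's condition for the full index set gives dimension (n - p) + p. *)
have full : (Vgstar T Sigma + \sum_(j <- enum 'I_p) <[x j]>)%VS = fullv.
  apply/eqP; rewrite eqEdim subvf /= dim_cV -[leqLHS]dimV.
  have := hx [set: 'I_p]%SET; rewrite cardsT card_ord.
  by under eq_bigl do rewrite inE; rewrite big_enum.
exists F, mu; split=> //.
  by apply/stable_fullP; rewrite -full.
(* The row identity is tested on this spanning family. The output map kills the invariant space
   [Vgstar]; at [x j] the defect is (mu j - mu i) times the [i]-th output component, where one
   factor vanishes in each of the cases i = j and i != j. *)
move=> i; apply/eqP; rewrite -subr_eq0 -row_mul -linearZ -linearB /=.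
set N := closed_output _ _ *m _ - _.
suff : (fullv <= lker (mxfun (row i N)))%VS.
  move/subvP => h; apply/eqP/row_matrixP => k; rewrite ord1 row0.
  apply/matrixP => a j; rewrite ord1 [RHS]mxE.
  have := h (delta_mx j 0) (memvf _); rewrite memv_lker_mx -colE => /eqP.
  by move/matrixP/(_ 0 0); rewrite !mxE.
have NE (v : 'cV_n) : (row i N *m v == 0) = ((N *m v) i 0 == 0).
  rewrite -row_mul; apply/eqP/eqP => [/matrixP/(_ 0 0)|h].
    by rewrite [LHS]mxE [RHS]mxE.
  by apply/matrixP => a b; rewrite !ord1 [LHS]mxE h mxE.
have NvE (v : 'cV_n) : N *m v =
    closed_output Sigma F *m (closed_loop Sigma F *m v) -
    mu i *: (closed_output Sigma F *m v).
  by rewrite mulmxBl -scalemxAl mulmxA.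
rewrite -full subv_add; apply/andP; split.
  apply/subvP => v /hV[v1 v2]; rewrite memv_lker_mx NE NvE v2 (hV _ v1).2.
  by rewrite scaler0 subr0 mxE.
rewrite big_enum; apply/subv_sumP => j _; rewrite -memvE memv_lker_mx NE NvE Mx.
rewrite -scalemxAr -scalerBl mxE; have [->|ij] := eqVneq i j.
  by rewrite subrr mul0r.
have [_ _ h] := hx' j; rewrite closed_outputE Fx h ?mulr0 //.
Qed.

End Sufficiency.

(** * Monotonic decay and trajectories *)

Section MonotoneDecay.
Variable R : realType.

Lemma monotonic_decay_scale d (I : porderType d) (time : set I)
    (decay g e : I -> R) (c : R) :
  (forall t, time t -> 0 < g t <= decay t) ->
  {in time &, {homo g : s t / (s < t)%O >-> t < s}} ->
  (forall t, time t -> e t = c * g t) -> monotonic_decay time decay e.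
Proof.
move=> hg mg he.
have mg' : {in time &, {homo g : s t / (s <= t)%O >-> t <= s}}.
  move=> s t st tt; rewrite le_eqVlt => /predU1P[->//|h].
  by apply/ltW/mg.
split.
- exists `|c| => t tt; rewrite he // normrM ler_wpM2l //.
  by have /andP[g0 gd] := hg _ tt; rewrite gtr0_norm.
- have [c0|c0] := leP 0 c; [right|left] => s t st tt h;
    rewrite !he ?inE //; try exact: set_mem.
    by rewrite ler_wpM2l ?mg'.
  by rewrite ler_wnM2l ?mg' // ltW.
- have sub t : t \in time `&` [set t | e t != 0] ->
      [/\ t \in time, time t & c != 0].
    move/set_mem => [tt /=]; rewrite he // mulf_eq0 negb_or => /andP[c0 _].
    by split=> //; apply/mem_set.
  have [c0|c0] := leP 0 c; [right|left] => s t /sub[st st' cn0] /sub[tt tt' _] h;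
    rewrite !he //.
    by rewrite ltr_pM2l ?mg // lt_def cn0.
  by rewrite ltr_nM2l ?mg.
Qed.

Lemma monotonic_decay_zero d (I : porderType d) (time : set I)
    (decay e : I -> R) t0 :
  time t0 -> (forall t, time t -> (t0 <= t)%O) ->
  (forall t eps, time t -> 0 < eps ->
     exists s, [/\ time s, (t <= s)%O & 0 <= decay s < eps]) ->
  monotonic_decay time decay e -> e t0 = 0 ->
  forall t, time t -> e t = 0.
Proof.
move=> tt0 ht0 hdecay [[b hb] mon _] e0 t tt.
have small eps : 0 < eps -> exists s, [/\ time s, (t <= s)%O & `|e s| < eps].
  move=> eps0; have b1 : 0 < `|b| + 1 by rewrite ltr_wpDl.
  have [s [ts hts /andP[d0 hs]]] :=
    hdecay t (eps / (`|b| + 1)) tt (divr_gt0 eps0 b1).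
  exists s; split=> //; apply: le_lt_trans (hb _ ts) _.
  apply: le_lt_trans (_ : (`|b| + 1) * decay s < eps).
    by rewrite ler_wpM2r // (le_trans (ler_norm _)) // lerDl.
  by rewrite mulrC -ltr_pdivlMr.
apply/eqP; rewrite -normr_le0 leNgt; apply/negP => h.
have [s [ts hts]] := small _ h; apply/negP; rewrite -leNgt.
have t0t := ht0 _ tt.
case: mon => mon.
  have h1 : 0 <= e t by rewrite -e0; apply: mon; rewrite ?inE.
  have h2 : e t <= e s by apply: mon; rewrite ?inE.
  by rewrite !ger0_norm // (le_trans h1).
have h1 : e t <= 0 by rewrite -e0; apply: mon; rewrite ?inE.
have h2 : e s <= e t by apply: mon; rewrite ?inE.
by rewrite !ler0_norm ?lerN2 // (le_trans h2).
Qed.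

Lemma expR_decay_small (rho t eps : R) : rho < 0 -> 0 < eps ->
  exists s, [/\ `[0, +oo[%classic s, (t <= s)%O & 0 <= expR (rho * s) < eps].
Proof.
(* The last term forces rho s <= ln eps - 1, since [rho] is negative. *)
move=> r0 e0; pose s := Num.max (Num.max 0 t) ((ln eps - 1) / rho).
have s0 : 0 <= s by rewrite !le_max lexx.
exists s; split; first by rewrite /= in_itv /= s0.
  by rewrite /s !le_max lexx orbT.
rewrite expR_ge0 /= -[ltRHS]lnK ?posrE // ltr_expR.
apply: le_lt_trans (_ : ln eps - 1 < _); last by rewrite ltrBlDr ltrDl.
rewrite mulrC -ler_ndivrMr //; by rewrite /s le_max lexx orbT.
Qed.

Lemma exp_decay_small (rho eps : R) (t : nat) : 0 < rho < 1 -> 0 < eps ->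
  exists s, [/\ [set: nat] s, (t <= s)%O & 0 <= rho ^+ s < eps].
Proof.
move=> /andP[r0 r1] e0.
have : (GRing.exp rho : R ^nat) @ \oo --> (0 : R).
  by apply: cvg_expr; rewrite ger0_norm ?ltW.
move/cvgrPdist_lt => /(_ _ e0)[N _ hN]; exists (maxn N t); split=> //.
  by rewrite leEnat leq_maxr.
rewrite exprn_ge0 ?(ltW r0) //=.
have := hN (maxn N t) (leq_maxl _ _); rewrite sub0r normrN ger0_norm //.
by rewrite exprn_ge0 ?ltW.
Qed.

End MonotoneDecay.

(** * Exponential solutions of linear differential equations *)

Section Trajectories.
Variable R : realType.

(** The product of [e] with exp(- mu s) has zero derivative inside the interval; the mean value
    theorem needs only continuity at the endpoint 0. *)
Lemma exp_ode_unique (e : R -> R) (mu : R) :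
  {within `[0, +oo[, continuous e} ->
  (forall t : R, 0 < t -> is_derive t (1 : R) e (mu * e t)) ->
  forall t : R, 0 <= t -> e t = e 0 * expR (mu * t).
Proof.
move=> ce de t; rewrite le_eqVlt => /predU1P[<-|t0].
  by rewrite mulr0 expR0 mulr1.
pose g := fun s => e s * expR (- mu * s).
have dg s : s \in `]0, t[ -> is_derive s (1 : R) g 0.
  rewrite in_itv /= => /andP[s0 _].
  have des := de _ s0.
  have dm : is_derive s (1 : R) (fun s => - mu * s) (- mu).
    have -> : (fun s => - mu * s) = - mu *: (id : R -> R) by apply/funext.
    by apply: is_derive_eq; rewrite scaler1.
  have dx : is_derive s (1 : R) (fun s => expR (- mu * s))
      (expR (- mu * s) * - mu).
    exact: (@is_derive1_comp _ expR).
  rewrite /g; apply: is_derive_eq.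
  by rewrite /GRing.scale /=; ring.
have cg : {within `[0, t], continuous g}.
  move=> x; apply: cvgM.
    apply: (continuous_subspaceW _ ce) => z /=.
    by rewrite !in_itv /= => /andP[->].
  apply: continuous_subspaceT => z.
  apply: (@continuous_comp _ _ _ (fun s => - mu * s)).
    exact: mulrl_continuous.
  exact: continuous_expR.
have [c _ ] := MVT t0 dg cg; rewrite mul0r => /eqP.
rewrite subr_eq0 /g mulr0 expR0 mulr1 => /eqP <-.
by rewrite -mulrA -expRD mulNr addNr expR0 mulr1.
Qed.

Lemma linear_form_continuous n p (C : 'M[R]_(p, n)) k :
  continuous (fun v : 'cV[R]_n => (C *m v) k 0).
Proof.
have coord_cont (j : 'I_n) : continuous (fun v : 'cV[R]_n => v j 0 : R).
  exact: coord_continuous.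
have scale_cont (j : 'I_n) : continuous (fun v : 'cV[R]_n => C k j * v j 0 : R).
  by move=> v; have h := coord_cont j v; exact: cvgMl_tmp h.
have -> : (fun v : 'cV[R]_n => (C *m v) k 0) = (fun v => \sum_j C k j * v j 0).
  by apply/funext => v; rewrite mxE.
apply: continuous_big => [|j _]; first exact: add_continuous.
exact: scale_cont.
Qed.

Lemma is_derive_linear_form n p (C : 'M[R]_(p, n)) k (xi : R -> 'cV[R]_n) t dxi :
  is_derive t (1 : R) xi dxi ->
  is_derive t (1 : R) (fun s => (C *m xi s) k 0) ((C *m dxi) k 0).
Proof.
move=> dx.
have dj j : is_derive t (1 : R) (fun s => xi s j 0) (dxi j 0).
  have ex : derivable xi t 1 by [].
  apply: DeriveDef; first exact: (derivable_mxP _ _ _).1.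
  by have := derive_mx ex; rewrite derive_val => ->; rewrite mxE.
have -> : (fun s => (C *m xi s) k 0) =
    \sum_(j < n) (C k j *: (fun s => xi s j 0)).
  by apply/funext => s; rewrite mxE fct_sumE.
by rewrite mxE; apply: is_derive_sum => j.
Qed.

(** Exponential generating function of [u]. For u k a coordinate of M^k x0 it is that coordinate of
    exp(tM) x0. *)
Definition exp_series (u : nat -> R) (t : R) : R :=
  limn (pseries (fun k => u k / k`!%:R) t).

Definition geometric_bound (u : nat -> R) : Prop :=
  exists B C, forall k, `|u k| <= B * C ^+ k.

Lemma exp_series_cvg u t : geometric_bound u ->
  cvgn (pseries (fun k => u k / k`!%:R) t).
Proof.
move=> [B [C hu]]; apply: normed_cvg.
pose v := B *: exp_coeff (C * `|t|).
have huv k : `|u k / k`!%:R * t ^+ k| <= v k.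
  rewrite !normrM normfV normr_nat normrX /v /exp_coeff /= /GRing.scale /=.
  rewrite (_ : B *: _ = B * C ^+ k / k`!%:R * `|t| ^+ k).
    by rewrite !ler_wpM2r ?exprn_ge0 ?invr_ge0 ?ler0n.
  by rewrite /GRing.scale /= exprMn; ring.
apply: (@series_le_cvg _ _ v) => [k|k|k|].
- exact: normr_ge0.
- exact: le_trans (normr_ge0 _) (huv k).
- exact: huv.
- exact/is_cvg_seriesZ/is_cvg_series_exp_coeff.
Qed.

Lemma geometric_bound_shift u :
  geometric_bound u -> geometric_bound (fun k => u k.+1).
Proof.
by move=> [B [C hu]]; exists (B * C), C => k; rewrite -mulrA -exprS.
Qed.

Lemma pseries_diffs_exp (u : nat -> R) :
  pseries_diffs (fun k => u k / k`!%:R) = fun k => u k.+1 / k`!%:R.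
Proof.
apply/funext => k; rewrite /pseries_diffs factS natrM invfM mulrCA.
by rewrite mulVKf.
Qed.

(** Differentiation shifts the coefficients. Termwise differentiation asks for convergence of the
    series and its first two formal derivatives beyond |t|; shifts inherit the geometric bound. *)
Lemma is_derive_exp_series u (t : R) : geometric_bound u ->
  is_derive t (1 : R) (exp_series u) (exp_series (fun k => u k.+1) t).
Proof.
move=> hu; rewrite /exp_series -pseries_diffs_exp.
have hu1 := geometric_bound_shift hu; have hu2 := geometric_bound_shift hu1.
apply: (@pseries_snd_diffs _ _ (`|t| + 1)); rewrite ?pseries_diffs_exp.
- exact: exp_series_cvg.
- exact: exp_series_cvg.
- exact: exp_series_cvg.
- by rewrite [ltRHS]ger0_norm ?addr_ge0 // ltrDl.
Qed.

Lemma exp_series0 u : exp_series u 0 = u 0%N.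
Proof.
apply/cvg_lim => //; rewrite -cvg_shiftS; apply: cvg_near_cst.
near=> k; rewrite /= /pseries /series /= big_nat_recl // fact0 expr0 mulr1 divr1.
by rewrite big1 ?addr0 // => i _; rewrite exprS mul0r mulr0.
Unshelve. all: by end_near. Qed.

Lemma exp_series_linear n (a : 'I_n -> R) (u : 'I_n -> nat -> R) t :
  (forall j, geometric_bound (u j)) ->
  exp_series (fun k => \sum_j a j * u j k) t = \sum_j a j * exp_series (u j) t.
Proof.
move=> hu; apply/cvg_lim => //.
have -> : pseries (fun k => (\sum_j a j * u j k) / k`!%:R) t =
    fun N => \sum_j a j * pseries (fun k => u j k / k`!%:R) t N.
  apply/funext => N; rewrite /pseries /series /=.
  under [RHS]eq_bigr do rewrite mulr_sumr.
  rewrite exchange_big /=; apply: eq_bigr => k _.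
  by rewrite !mulr_suml; apply: eq_bigr => j _; rewrite !mulrA.
apply: cvg_big => [|j _]; first exact: add_continuous.
by apply: cvgMl_tmp; apply: exp_series_cvg.
Qed.

(** A hypothesis on all trajectories says something about [x0] only once a trajectory through it is
    exhibited. It is differentiable on the whole line, so its derivative at 0 can be used. *)
Lemma ct_trajectory_exists n (M : 'M[R]_n) (x0 : 'cV[R]_n) :
  exists xi : R -> 'cV[R]_n, xi 0 = x0 /\
    forall t, is_derive t (1 : R) xi (M *m xi t).
Proof.
pose v k := iter k (mulmx M) x0.
pose u j k := v k j 0.
have hu j : geometric_bound (u j).
  pose C := \sum_i \sum_j `|M i j|; pose B := \sum_j `|x0 j 0|.
  have B0 : 0 <= B by apply: sumr_ge0.
  have C0 : 0 <= C by apply: sumr_ge0 => i _; apply: sumr_ge0.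
  exists B, C => k; elim: k j => [|k IH] j.
    by rewrite expr0 mulr1 /u /= /B (bigD1 j) //= lerDl sumr_ge0.
  rewrite /u /= mxE; apply: le_trans (ler_norm_sum _ _ _) _.
  apply: le_trans (_ : \sum_l `|M j l| * (B * C ^+ k) <= _).
    by apply: ler_sum => l _; rewrite normrM ler_wpM2l //; apply: IH.
  rewrite -mulr_suml exprS [leRHS]mulrCA ler_wpM2r ?mulr_ge0 ?exprn_ge0 //.
  by rewrite /C [leRHS](bigD1 j) //= lerDl sumr_ge0 // => i _; apply: sumr_ge0.
exists (fun t => \col_j exp_series (u j) t); split.
  by apply/matrixP => i j; rewrite ord1 mxE exp_series0.
move=> t.
have d i j : is_derive t (1 : R) (fun s => (\col_j exp_series (u j) s) i j)
    (\sum_l M i l * exp_series (u l) t).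
  have -> : (fun s => (\col_j exp_series (u j) s) i j) = exp_series (u i).
    by apply/funext => s; rewrite mxE.
  rewrite -exp_series_linear //.
  have -> : (fun k => \sum_l M i l * u l k) = (fun k => u i k.+1).
    by apply/funext => k; rewrite /u /= mxE.
  exact: is_derive_exp_series.
have dm : derivable (fun s => \col_j exp_series (u j) s) t 1.
  by apply/derivable_mxP => i j; apply: ex_derive.
apply: DeriveDef => //; rewrite derive_mx //.
apply/matrixP => i j; rewrite mxE derive_val mxE.
by apply: eq_bigr => l _; rewrite mxE.
Qed.

Lemma vanishing_right_derive (f : R -> R) df : is_derive (0 : R) (1 : R) f df ->
  (forall t, 0 <= t -> f t = 0) -> df = 0.
Proof.
move=> d hf.
have h : h^-1 *: ((f \o shift 0) (h *: (1 : R)) - f 0) @[h --> 0^'] --> df.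
  have := ex_derive (is_derive := d).
  by rewrite -[X in _ --> X](derive_val (is_derive := d)).
have := cvg_dnbhs_at_right h => h'.
suff : h^-1 *: ((f \o shift 0) (h *: (1 : R)) - f 0) @[h --> 0^'+] --> (0 : R).
  by move=> h''; apply: cvg_unique h' h''.
apply: cvg_near_cst; near=> s.
rewrite /= addr0 (hf 0) // subr0 hf ?scaler0 // /GRing.scale /= mulr1.
by apply: ltW; near: s; apply: nbhs_right_gt.
Unshelve. all: by end_near. Qed.

End Trajectories.

Section ClosedLoopResponse.
Variables (R : realType) (T : time_domain) (n m p : nat).
Variables (Sigma : lti_system R n m p) (rho : R).
Hypothesis hrho : admissible_rate T rho.

Lemma ct_trajectory_of_derive (M : 'M[R]_n) xi :
  (forall t : R, is_derive t (1 : R) xi (M *m xi t)) -> ct_trajectory M xi.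
Proof.
move=> dxi; split=> [|t _]; last exact: dxi.
apply: continuous_subspaceT => t.
by apply/differentiable_continuous/derivable1_diffP; apply: ex_derive.
Qed.

(** The error component starts at 0 and hence vanishes for all times; the conclusion reads off its
    derivative at 0 in continuous time, its value at time 1 in discrete time. *)
Lemma solution_kernel (F : 'M[R]_(m, n)) (k : 'I_p) (x0 : 'cV[R]_n) :
  solves_global_monotonicity T Sigma rho F ->
  (closed_output Sigma F *m x0) k 0 = 0 ->
  (closed_output Sigma F *m (closed_loop Sigma F *m x0)) k 0 = 0.
Proof.
move=> [_ hF] x0k; case: T hrho hF => /= hr hF.
  have [xi [xi0 dxi]] := ct_trajectory_exists (closed_loop Sigma F) x0.
  have dec := hF _ (ct_trajectory_of_derive dxi) k.
  have e0 : forall t : R, 0 <= t -> tracking_error Sigma F xi k t = 0.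
    move=> t t0; apply: (monotonic_decay_zero (t0 := 0) _ _ _ dec).
    - by rewrite /= in_itv /= lexx.
    - by move=> s; rewrite /= in_itv /= andbT.
    - by move=> s eps _ eps0; apply: expR_decay_small.
    - by rewrite /tracking_error xi0.
    - by rewrite /= in_itv /= t0.
  have := is_derive_linear_form (closed_output Sigma F) k (dxi 0).
  by rewrite xi0 => d; apply: vanishing_right_derive d e0.
pose xi t := iter t (mulmx (closed_loop Sigma F)) x0.
have dec := hF xi (fun t => erefl) k.
have := monotonic_decay_zero (t0 := 0%N) (time := setT) _ _ _ dec.
move=> /(_ I (fun t _ => leq0n t)).
by move=> /(_ (fun t eps _ h => exp_decay_small t hr h) x0k 1%N I).
Qed.

Lemma diagonalising_feedback_solves (F : 'M[R]_(m, n)) (mu : 'I_p -> R) :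
  asymptotically_stable T Sigma F -> (forall i, decay_rate T rho (mu i)) ->
  (forall i, row i (closed_output Sigma F) *m closed_loop Sigma F =
             mu i *: row i (closed_output Sigma F)) ->
  solves_global_monotonicity T Sigma rho F.
Proof.
move=> sF hmu hrow; split=> //.
have e (x : 'cV[R]_n) k :
    (closed_output Sigma F *m (closed_loop Sigma F *m x)) k 0 =
    mu k * (closed_output Sigma F *m x) k 0.
  have rowE (N : 'M[R]_(p, n)) (y : 'cV[R]_n) : (N *m y) k 0 = (row k N *m y) 0 0.
    by rewrite -row_mul [RHS]mxE.
  by rewrite !rowE mulmxA hrow -scalemxAl mxE.
move: hmu; rewrite /decay_rate; case: T hrho => /= hr hmu.
  move=> xi [cxi dxi] k.
  have mu0 : mu k < 0 := le_lt_trans (hmu k) hr.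
  have ce : {within `[0, +oo[, continuous (tracking_error Sigma F xi k)}.
    move=> x; set C := closed_output Sigma F.
    have hC := @linear_form_continuous _ _ _ C k (xi x).
    exact: (continuous_comp (cxi x) hC).
  have de (t : R) : 0 < t -> is_derive t (1 : R) (tracking_error Sigma F xi k)
      (mu k * tracking_error Sigma F xi k t).
    move=> t0; rewrite [X in _ * X]/tracking_error -e.
    exact: is_derive_linear_form (dxi t t0).
  apply: (@monotonic_decay_scale _ _ _ _ _ (fun t => expR (mu k * t)) _
    (tracking_error Sigma F xi k 0)) => [t|s t _ _ st|t].
  - by rewrite /= in_itv /= andbT => t0; rewrite expR_gt0 ler_expR ler_wpM2r.
  - by rewrite ltr_expR ltr_nM2l.
  - by rewrite /= in_itv /= andbT => t0; rewrite -(exp_ode_unique ce de t0).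
move=> xi hxi k; have /andP[r0 r1] := hr; have /andP[m0 mr] := hmu k.
apply: (@monotonic_decay_scale _ _ _ _ _ (fun t => mu k ^+ t) _
    (tracking_error Sigma F xi k 0%N)) => [t _|s t _ _ st|t _].
- by rewrite exprn_gt0 //= lerXn2r // nnegrE ltW.
- by rewrite ltr_iXn2l // (le_lt_trans mr).
- elim: t => [|t IH]; first by rewrite expr0 mulr1.
  by rewrite /tracking_error hxi e -/(tracking_error _ _ _ _ _) IH exprS mulrCA.
Qed.

End ClosedLoopResponse.

(** * Necessity *)

Section PolynomialCurves.
Variable R : realType.

Lemma poly_vanish_generic (q r : {poly R}) : q != 0 ->
  (forall mu, ~~ root q mu -> r.[mu] = 0) -> r = 0.
Proof.
move=> q0 h; suff /eqP : r * q = 0 by rewrite mulf_eq0 (negPf q0) orbF => /eqP.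
apply: contraTeq isT => rq0.
pose s := [seq k%:R : R | k <- iota 0 (size (r * q))].
have us : uniq s.
  by rewrite map_inj_uniq ?iota_uniq // => k l /eqP; rewrite eqr_nat => /eqP.
have rs : all (root (r * q)) s.
  apply/allP => mu _; rewrite rootM.
  by have [|/h rmu] := boolP (root q mu); rewrite ?orbT // /root rmu eqxx.
by have := max_poly_roots rq0 rs us; rewrite size_map size_iota ltnn.
Qed.

Lemma subspace_equation n (Y : {vspace 'cV[R]_n}) :
  exists Z : 'M[R]_n, forall y, (y \in Y) = (Z *m y == 0).
Proof.
have [P hP] := lfun_mx (projv Y).
exists (1%:M - P) => y; rewrite mulmxBl mul1mx hP /= subr_eq0 eq_sym.
apply/idP/eqP => [/projv_id //|<-]; exact: memv_proj.
Qed.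

(** Algebraic substitute for a limit: the linear equations of [Y], evaluated along the curve, are
    polynomials that vanish off the roots of [q], hence everywhere. *)
Lemma curve_in_subspace n (Y : {vspace 'cV[R]_n}) (y : 'cV[{poly R}]_n)
    (q : {poly R}) (mu0 : R) : q != 0 ->
  (forall mu, ~~ root q mu -> map_mx (horner_eval mu) y \in Y) ->
  map_mx (horner_eval mu0) y \in Y.
Proof.
move=> q0 h; have [Z hZ] := subspace_equation Y.
have eZ mu : Z *m map_mx (horner_eval mu) y =
    map_mx (horner_eval mu) (map_mx polyC Z *m y).
  rewrite map_mxM /=; congr (_ *m _).
  by apply/matrixP => i j; rewrite !mxE /horner_eval hornerC.
rewrite hZ eZ; suff -> : map_mx polyC Z *m y = 0 by rewrite map_mx0.
apply/matrixP => i j; rewrite [RHS]mxE; apply: poly_vanish_generic q0 _.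
move=> mu /h; rewrite hZ eZ => /eqP/matrixP/(_ i j).
by rewrite [LHS]mxE [RHS]mxE.
Qed.

End PolynomialCurves.

Section Necessity.
Variables (R : realType) (T : time_domain) (n m p : nat).
Variables (Sigma : lti_system R n m p) (F : 'M[R]_(m, n)).
Hypothesis stable_F : asymptotically_stable T Sigma F.
Hypothesis kernel_F : forall (k : 'I_p) (x : 'cV[R]_n),
  (closed_output Sigma F *m x) k 0 = 0 ->
  (closed_output Sigma F *m (closed_loop Sigma F *m x)) k 0 = 0.
Hypothesis dimV : (\dim (Vgstar T Sigma) + p = n)%N.
Hypothesis rinv : right_invertible Sigma.

Let A := Amx Sigma.
Let B := Bmx Sigma.
Let D := Dmx Sigma.
Let M := closed_loop Sigma F.
Let N := closed_output Sigma F.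
Let K := lker (mxfun N).

Let memK x : (x \in K) = (N *m x == 0).
Proof. exact: memv_lker_mx. Qed.

Let stable_M V : stable_on T M V.
Proof.
apply: stable_on_sub (subvf V) _; exact/stable_fullP.
Qed.

Let K_invariant : mx_invariant M K.
Proof.
apply/mx_invariantP => x; rewrite !memK => /eqP Nx.
apply/eqP/matrixP => k j; rewrite ord1 [RHS]mxE; apply: kernel_F.
by rewrite -/N Nx mxE.
Qed.

Let K_sub : (K <= Vgstar T Sigma)%VS.
Proof.
apply: (Vgstar_sup (F := F)); split; last exact: stable_M.
by split=> //; exact: subvv.
Qed.

Let dimK : (\dim K + \dim (limg (mxfun N)) = n)%N.
Proof. by have := limg_ker_dim (mxfun N) fullv; rewrite capfv dim_cV. Qed.

(** [K] lies in [Vgstar], so its dimension is at most n - p and the rank of [N] is at least p. *)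
Let limgN : limg (mxfun N) = fullv.
Proof.
apply/eqP; rewrite eqEdim subvf dim_cV /= -(leq_add2l (\dim K)) dimK -{2}dimV.
by rewrite leq_add2r dimvS.
Qed.

Let KE : K = Vgstar T Sigma.
Proof.
apply/eqP; rewrite eqEdim K_sub -(leq_add2r p) dimV -[leqLHS]dimK limgN dim_cV.
exact: leqnn.
Qed.

Let N_surj (y : 'cV[R]_p) : exists x, N *m x = y.
Proof.
have : y \in limg (mxfun N) by rewrite limgN memvf.
by case/memv_imgP => x _ ->; exists x; rewrite mxfunE.
Qed.

Let N_row_free (b : 'rV[R]_p) : b *m N = 0 -> b = 0.
Proof.
move=> bN; apply/matrixP => i k; have [x Nx] := N_surj (delta_mx k 0).
have := congr1 (mulmx^~ x) bN; rewrite mul0mx -mulmxA Nx -colE.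
by move/matrixP/(_ i 0); rewrite !mxE.
Qed.

(** A linear form with invariant kernel is an eigenform; its eigenvalue is read off at a vector that
    [N] maps to the basis vector. That it is a root of the characteristic polynomial later separates
    it from the generic rates. *)
Lemma output_rates : exists lam : 'I_p -> R,
  (forall k, stable_point T (lam k) 0 /\ root (char_poly M) (lam k)) /\
  N *m M = diag_mx (\row_k lam k) *m N.
Proof.
have hl k : exists l, forall x : 'cV_n, (N *m (M *m x)) k 0 = l * (N *m x) k 0.
  have [z Nz] := N_surj (delta_mx k 0).
  exists ((N *m (M *m z)) k 0) => x.
  have : (N *m (x - (N *m x) k 0 *: z)) k 0 = 0.
    by rewrite mulmxBr -scalemxAr Nz !mxE !eqxx mulr1 subrr.
  move/kernel_F; rewrite -/N -/M !mulmxBr -!scalemxAr !mxE => /eqP.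
  by rewrite subr_eq0 => /eqP ->; rewrite mulrC.
have [lam hlam] := boolp.choice hl.
have rowM k : row k N *m M = lam k *: row k N.
  apply/row_matrixP => i; rewrite ord1; apply/matrixP => a j; rewrite ord1.
  rewrite -!row_mul.
  have := hlam k (delta_mx j 0); rewrite !mulmxA -!colE.
  by rewrite !mxE.
exists lam; split=> [k|].
  have row0 : row k N != 0.
    apply: contraTneq isT => h; have := @N_row_free (delta_mx 0 k).
    rewrite -rowE => /(_ h)/matrixP/(_ 0 k)/eqP.
    by rewrite !mxE !eqxx oner_eq0.
  have ev : eigenvalue M (lam k) by apply/eigenvalueP; exists (row k N).
  split; last by rewrite -eigenvalue_root_char.
  apply/stability_regionE/stable_F/spectrum_rowP; exists (row k N), 0.
  by rewrite row0 /= rowM !scale0r !scaler0 subr0 addr0 mul0mx.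
apply/row_matrixP => k; rewrite row_mul rowM.
by apply/matrixP => i j; rewrite mul_diag_mx !mxE.
Qed.

Variable lam : 'I_p -> R.
Hypothesis lam_stable : forall k, stable_point T (lam k) 0.
Hypothesis lam_root : forall k, root (char_poly M) (lam k).
Let Lam := diag_mx (\row_k lam k).
Hypothesis NM : N *m M = Lam *m N.

(** Numerator of the closed-loop transfer matrix: N M = Lam N gives N (s - M)^-1 B + D = (s -
    Lam)^-1 G(s). *)
Definition output_pencil (s : R) : 'M[R]_(p, m) := N *m B - Lam *m D + s *: D.
Local Notation G := output_pencil.

Let output_pencilD s t : G s = G t + (s - t) *: D.
Proof. by rewrite /G -[RHS]addrA -scalerDl (addrC t) subrK. Qed.

(* [b G(s) = 0] gives the left null vector [(b N, - b (Lam - s))] of the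
   system pencil. *)
Lemma output_pencil_free : exists s, row_free (G s).
Proof.
have [s hs] : exists s : R, \rank (system_matrix Sigma s%:C%C) = (n + p)%N.
  apply: contrapT => /forallNP h.
  apply: infinite_nat.
  have inj : injective (fun k : nat => (k%:R : R)%:C%C).
    by move=> k l /complexI/eqP; rewrite eqr_nat => /eqP.
  apply: sub_finite_set (finite_preimage (in2W inj) rinv) => k _ /=.
  exact/eqP/h.
exists s; apply: inj_row_free => b bG.
pose P := block_mx (A - s%:M) B (Cmx Sigma) D.
have PE : system_matrix Sigma s%:C%C = complexify P.
  rewrite /system_matrix /system_pencil /complexify !map_block_mx.
  congr block_mx; apply/matrixP => i j; rewrite !mxE ?hornerC //.
  by rewrite hornerD hornerN hornerMn hornerX hornerC rmorphB rmorphMn.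
have Pfree : row_free P.
  apply/eqP; transitivity (\rank (complexify P)); last by rewrite -PE.
  by rewrite /complexify mxrank_map.
pose w := row_mx (b *m N) (- (b *m (Lam - s%:M))).
have wP : w *m P = 0.
  rewrite mul_row_block; apply/eqP; rewrite row_mx_eq0; apply/andP; split.
    have -> : A = M - B *m F by rewrite /M /closed_loop addrK.
    have -> : Cmx Sigma = N - D *m F by rewrite /N /closed_output addrK.
    apply/eqP; rewrite mulNmx -!mulmxA -mulmxBr.
    suff -> : N *m (M - B *m F - s%:M) - (Lam - s%:M) *m (N - D *m F) =
        - (G s *m F).
      by rewrite mulmxN mulmxA bG mul0mx oppr0.
    rewrite !mulmxBr NM !mulmxBl !mulmxDl mulNmx -scalemxAl.
    rewrite !mul_scalar_mx !mul_mx_scalar.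
    rewrite !mulmxA.
    by apply/matrixP => i j; rewrite !mxE; ring.
  apply/eqP; rewrite mulNmx -!mulmxA -mulmxBr -[RHS]bG; congr (b *m _).
  by rewrite mulmxBl mul_scalar_mx opprB addrA addrAC.
have : w = 0 by apply: (row_free_inj Pfree); rewrite wP mul0mx.
by move/eqP; rewrite row_mx_eq0 => /andP[/eqP/N_row_free].
Qed.

(** Otherwise take x with N x = - D u. The extra input [u] at x nulls the output, and N (M x + B u -
    l x) = G(l) u = 0 keeps the motion in [K + <[x]>] with new eigenvalue [l], against the
    maximality of [K]. *)
Lemma output_pencil_stable_kernel (l : R) (u : 'cV[R]_m) :
  stable_point T l 0 -> G l *m u = 0 -> D *m u = 0.
Proof.
move=> sl Gu; have [x Nx] := N_surj (- (D *m u)).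
apply: contrapT => /eqP Du.
have xK : x \notin K by rewrite memK Nx oppr_eq0.
have [H [HK Hx]] := extend_feedback F (F *m x + u) xK.
have Hloop : {in K, forall v, closed_loop Sigma H *m v = M *m v}.
  by move=> v vK; rewrite /M !closed_loopE HK.
have Hout : {in K, forall v, closed_output Sigma H *m v = 0}.
  move=> v vK; rewrite closed_outputE HK // -closed_outputE.
  by apply/eqP; rewrite -memK.
have Hxl : closed_loop Sigma H *m x = M *m x + B *m u.
  by rewrite closed_loopE Hx mulmxDr addrA -closed_loopE.
have Hxo : closed_output Sigma H *m x = 0.
  by rewrite closed_outputE Hx mulmxDr addrA -closed_outputE -/N Nx addNr.
have HK' : mx_invariant (closed_loop Sigma H) K.
  apply/mx_invariantP => v vK; rewrite Hloop //.
  exact: (mx_invariantP _ _).1.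
have dK : closed_loop Sigma H *m x - l *: x \in K.
  rewrite memK Hxl mulmxBr mulmxDr mulmxA NM -mulmxA Nx -scalemxAr Nx.
  apply/eqP; rewrite -[RHS]Gu /G !mulmxDl mulNmx -scalemxAl -!mulmxA.
  by rewrite mulmxN scalerN opprK [X in X + _]addrC.
suff : (K + <[x]> <= Vgstar T Sigma)%VS.
  by rewrite subv_add -KE -memvE (negPf xK) andbF.
apply: (Vgstar_sup (F := H)); split.
  apply/output_nullingP => _ /memv_addP[v vK [_ /vlineP[c ->] ->]].
  rewrite !mulmxDr -!scalemxAr Hout // Hxo scaler0 addr0; split=> //.
  have -> : closed_loop Sigma H *m x =
      (closed_loop Sigma H *m x - l *: x) + l *: x by rewrite subrK.
  rewrite scalerDr addrA; apply: memv_add.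
    by rewrite rpredD ?rpredZ // (mx_invariantP _ _).1.
  by rewrite !rpredZ // memv_line.
apply: stable_on_line sl _ => //.
by apply: (@stable_on_ext _ _ _ M) => // v vK; rewrite Hloop.
Qed.

Lemma kernel_submx k1 k2 q (X : 'M[R]_(k1, q)) (Y : 'M[R]_(k2, q)) :
  (forall u : 'cV_q, X *m u = 0 -> Y *m u = 0) -> (Y <= X)%MS.
Proof.
move=> h; rewrite submxE; apply/eqP/matrixP => i j.
have : X *m (cokermx X *m delta_mx j (0 : 'I_1)) = 0.
  by rewrite mulmxA mulmx_coker mul0mx.
move/h; rewrite mulmxA -colE => /matrixP/(_ i 0).
by rewrite [LHS]mxE => ->; rewrite !mxE.
Qed.

(** Since G(s) - G(l) is a multiple of [D], the kernel of G(l) lies in that of every G(s); the rank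
    at [l] is thus no smaller than at a point of full row rank. *)
Lemma output_pencil_rinv (l : R) : stable_point T l 0 ->
  exists U : 'M[R]_(m, p), G l *m U = 1%:M.
Proof.
move=> sl; apply/row_freeP; have [s Gs] := output_pencil_free.
have /mxrankS : (G s <= G l)%MS.
  apply: kernel_submx => u Gu.
  rewrite (output_pencilD s l) mulmxDl Gu -scalemxAl.
  by rewrite (output_pencil_stable_kernel sl Gu) scaler0 addr0.
rewrite (eqP Gs) => h; rewrite /row_free eqn_leq h andbT; exact: rank_leq_row.
Qed.

(* The polynomial curve [y] has values in the image for almost all [mu], hence
   also at [mu = lam j], where it passes through the [j]-th basis vector. *)
Lemma output_direction_reached (j : 'I_p) :
  delta_mx j 0 \in (mxfun N @: Rstar_without Sigma j)%VS.
Proof.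
set l := lam j; have [U GU] := output_pencil_rinv (lam_stable j).
have [q [q0 hq]] := eigen_direction_Rstar (remove_output Sigma j).
(* [H] evaluates to G(mu) U, and to the identity at mu = l. The adjugate replaces its inverse so
   that [y] stays polynomial. *)
pose H : 'M[{poly R}]_p := 1%:M + ('X - l%:P) *: map_mx polyC (D *m U).
pose y : 'cV[{poly R}]_p := \det H *: delta_mx j 0 -
  ('X - l%:P) *: (map_mx polyC (D *m U) *m \adj H *m delta_mx j 0).
have evC a b (X : 'M[R]_(a, b)) mu : map_mx (horner_eval mu) (map_mx polyC X) = X.
  by apply/matrixP => i k; rewrite !mxE /horner_eval hornerC.
have evH mu : map_mx (horner_eval mu) H = 1%:M + (mu - l) *: (D *m U).
  by rewrite map_mxD map_mx1 map_mxZ evC /= /horner_eval hornerXsubC.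
have evy mu : map_mx (horner_eval mu) y =
    \det (1%:M + (mu - l) *: (D *m U)) *: delta_mx j 0 -
    (mu - l) *: (D *m U *m \adj (1%:M + (mu - l) *: (D *m U)) *m delta_mx j 0).
  have evdet : horner_eval mu (\det H) = \det (1%:M + (mu - l) *: (D *m U)).
    by rewrite -evH det_map_mx.
  rewrite map_mxB !map_mxZ !map_mxM map_mx_adj !evC evH map_delta_mx /= evdet.
  by rewrite /horner_eval hornerXsubC.
have -> : delta_mx j 0 = map_mx (horner_eval l) y.
  by rewrite evy subrr !scale0r addr0 det1 scale1r subr0.
have qM0 : q * char_poly M != 0 by rewrite mulf_neq0 ?char_poly_neq0.
apply: curve_in_subspace qM0 _ => mu; rewrite rootM negb_or => /andP[qmu Mmu].
rewrite evy; set Hm := 1%:M + _.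
have uM : M - mu%:M \in unitmx by apply: unitmx_sub_scalar.
(* The error e satisfies (Lam - mu) e = - G(mu) w. The factor mu - l in [w] cancels the [j]-th entry
   of Lam - mu, so that e is det(Hm) times the [j]-th basis vector. *)
pose w := (mu - l) *: (U *m \adj Hm *m (delta_mx j 0 : 'cV[R]_p)).
pose v := - (invmx (M - mu%:M) *m (B *m w)).
have Mv : M *m v = mu *: v - B *m w.
  apply/eqP; rewrite eq_sym subr_eq addrC -subr_eq -opprB.
  by rewrite -mul_scalar_mx -mulmxBl /v mulmxN opprK mulKVmx.
have Gw : G mu *m w = ((mu - l) * \det Hm) *: delta_mx j 0.
  rewrite (output_pencilD mu l) /w -scalemxAr !mulmxA mulmxDl GU -scalemxAl -/Hm.
  by rewrite mul_mx_adj mul_scalar_mx scalerA.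
pose e := N *m v + D *m w.
have lam_mu i : lam i != mu by apply: contraNneq Mmu => <-.
have he i : (lam i - mu) * e i 0 = - (G mu *m w) i 0.
  have hLam (z : 'cV[R]_p) : (Lam *m z) i 0 = lam i * z i 0.
    by rewrite mul_diag_mx !mxE.
  have comb (X Y Z : 'cV[R]_p) c : (X - Y + c *: Z) i 0 =
      X i 0 - Y i 0 + c * Z i 0 by rewrite !mxE.
  have sub (X Y : 'cV[R]_p) c : (c *: X - Y) i 0 = c * X i 0 - Y i 0.
    by rewrite !mxE.
  have hv : mu * (N *m v) i 0 - (N *m (B *m w)) i 0 = lam i * (N *m v) i 0.
    by rewrite -hLam (mulmxA Lam) -NM -(mulmxA N M) Mv mulmxBr -(scalemxAr mu) sub.
  rewrite /G mulmxDl mulmxBl -scalemxAl -!mulmxA comb hLam.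
  rewrite [e i 0]mxE mulrDr mulrBl -hv; ring.
have ej : e = \det Hm *: delta_mx j 0.
  apply/matrixP => i k; rewrite ord1; apply: (mulfI (x := lam i - mu)).
    by rewrite subr_eq0.
  rewrite he Gw !mxE; have [->|ij] := eqVneq i j; last by rewrite !mulr0 oppr0.
  by rewrite /= -/l; ring.
have vR : v \in Rstar_without Sigma j.
  apply: hq qmu _; exists (F *m v + w); split.
    by rewrite mulmxDr addrA -closed_loopE Mv subrK.
  apply/remove_output_eq0 => i ij.
  rewrite mulmxDr addrA -closed_outputE -/N -/e ej !mxE (negPf ij) /=.
  by rewrite mulr0.
have -> : \det Hm *: delta_mx j 0 - (mu - l) *:
    (D *m U *m \adj Hm *m delta_mx j 0) = mxfun N v.
  rewrite mxfunE -ej /e /w -scalemxAr !mulmxA addrK //.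
exact: memv_img.
Qed.

(** The kernel of [N] is [Vgstar], which lies in U, so dim U exceeds dim [Vgstar] by the dimension
    of the image of U under [N]; that image contains the basis vectors indexed by [S]. *)
Lemma output_directions_rado :
  rado_condition (Vgstar T Sigma) (Rstar_without Sigma).
Proof.
move=> S; set U := (_ + _)%VS.
have KU : (U :&: K)%VS = K by apply/capv_idPr; rewrite KE addvSl.
rewrite -(limg_ker_dim (mxfun N) U) -/K KU KE leq_add2l.
pose E (S : {set 'I_p}) := (\sum_(j in S) <[delta_mx j 0%R : 'cV[R]_p]>)%VS.
apply: leq_trans (dimvS (_ : E S <= _)%VS); last first.
  apply/subv_sumP => j jS; rewrite -memvE.
  apply: subvP (output_direction_reached j); apply: limgS.
  exact: subv_trans (sumv_sup j jS (subvv _)) (addvSr _ _).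
have dimE S' : (\dim (E S') <= #|S'|)%N.
  apply: leq_trans (dimv_leq_sum _ _ _) _.
  rewrite -sum1_card; apply: leq_sum => j _.
  by rewrite dim_vline leq_b1.
(* The lower bound on dim (E S) comes from the upper bound on its complementary counterpart. *)
have full : (fullv <= E S + E (~: S))%VS.
  apply/subvP => y _; rewrite (matrix_sum_delta y); apply: memv_suml => j _.
  rewrite big_ord1 rpredZ // memvE; have [jS|jS] := boolP (j \in S).
    by apply: subv_trans (addvSl _ _); apply: (sumv_sup j).
  by apply: subv_trans (addvSr _ _); apply: (sumv_sup j); rewrite // inE.
have := leq_trans (dimvS full) (dimv_add_leqif _ _); rewrite dim_cV => h.
rewrite -(leq_add2r #|~: S|) cardsC card_ord.
by apply: leq_trans h _; rewrite leq_add2l.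
Qed.

End Necessity.

Theorem theorem2 (R : realType) (T : time_domain) (n m p : nat)
    (Sigma : lti_system R n m p) (rho : R)
    (hSigma : standing_assumptions T Sigma)
    (hrho : admissible_rate T rho) :
  (exists F : 'M[R]_(m, n), solves_global_monotonicity T Sigma rho F) <->
  (forall S : {set 'I_p},
     (n - p + #|S| <=
      \dim (Vgstar T Sigma + \sum_(j in S) Rstar_without Sigma j)%VS)%N).
Proof.
have dimV := dim_Vgstar hSigma; have rinv := sys_right_invertible hSigma.
have -> : (n - p = \dim (Vgstar T Sigma))%N by rewrite -[in LHS]dimV addnK.
split=> [[F hF]|hR].
  have kerF k x := solution_kernel hrho (k := k) (x0 := x) hF.
  have [lam [hlam NM]] := output_rates hF.1 kerF dimV.
  apply: (output_directions_rado hF.1 kerF dimV rinv (lam := lam) _ _ NM) => k;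
    by case: (hlam k).
have [F [mu [sF hmu hrow]]] := exists_diagonalising_feedback hrho dimV hR.
by exists F; apply: diagonalising_feedback_solves hmu hrow.
Qed.
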